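(* Let $\nu=\eta>0$, let $\alpha,\beta\in\mathbb{R}$ be constants, and let $(\overline u_0,\overline B_0)$ be divergence-free vector fields satisfying $$\overline B_0+\nabla\times\overline u_0-\alpha\overline u_0=0,\qquad \overline u_0-\nabla\times\overline B_0+\beta\overline B_0=0.$$ Then there exists an exact solution $(\overline u,\overline B)$, for all $t\ge0$, of the viscous and resistive Hall MHD system $$u_t+\omega\times u+\nabla\overline p-\nu\Delta u=J\times B,\quad B_t+\nabla\times(B\times u)+\nabla\times(J\times B)-\eta\Delta B=0,\quad \operatorname{div}u=\operatorname{div}B=0$$ ($\omega=\nabla\times u$, $J=\nabla\times B$) starting from $(\overline u_0,\overline B_0)$, which is expressed as follows. (1) If $|\alpha-\beta|>2$, set $\lambda_1=\frac{\alpha+\beta+\sqrt{(\alpha-\beta)^2-4}}{2}$ and $\lambda_2=\frac{\alpha+\beta-\sqrt{(\alpha-\beta)^2-4}}{2}$. Then $(\overline u_0,\overline B_0)=(\overline u_0^1,\overline B_0^1)+(\overline u_0^2,\overline B_0^2)$ with $\overline u_0^i,\overline B_0^i\in\mathcal{B}_{\lambda_i}$ for $i=1,2$, and $$\overline u(t,x)=e^{-\nu\lambda_1^2t}\overline u_0^1(x)+e^{-\nu\lambda_2^2t}\overline u_0^2(x),\qquad \overline B(t,x)=e^{-\nu\lambda_1^2t}\overline B_0^1(x)+e^{-\nu\lambda_2^2t}\overline B_0^2(x).$$ (2) If $|\alpha-\beta|=2$, set $\lambda=\frac{\alpha+\beta}{2}$. Then $$\overline u(t,x)=e^{-\nu\lambda^2t}\overline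 u_0(x)-2\nu\lambda te^{-\nu\lambda^2t}\left(\nabla\times\overline u_0(x)-\lambda\overline u_0(x)\right),$$ $$\overline B(t,x)=e^{-\nu\lambda^2t}\overline B_0(x)-2\nu\lambda te^{-\nu\lambda^2t}\left(\nabla\times\overline B_0(x)-\lambda\overline B_0(x)\right).$$
   Context: The spatial domain is $\mathbb{R}^3$ or $\mathbb{T}^3=[-\pi,\pi]^3$ (periodic). No integrability is assumed on the fields; since $\alpha,\beta$ are constants, $\overline u_0,\overline B_0$ are smooth. For a real constant $\lambda$ (possibly $0$), $\mathcal{B}_\lambda=\{u\in C^1:\nabla\times u=\lambda u,\ \operatorname{div}u=0\}$. *)

(* Defs.v *)
From HB Require Import structures.
From mathcomp Require Import all_boot all_order all_algebra.
From mathcomp Require Import all_classical all_reals all_analysis.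

Set Implicit Arguments.
Unset Strict Implicit.
Unset Printing Implicit Defensive.

Import Order.TTheory GRing.Theory Num.Theory.
Import numFieldNormedType.Exports.

Local Open Scope classical_set_scope.
Local Open Scope ring_scope.

Notation scalar_field R := ('rV[R]_3 -> R).
Notation vector_field R := ('rV[R]_3 -> 'rV[R]_3).

(* Fields on the torus [-pi, pi]^3 are the fields on the whole space that are
   2 pi-periodic in each coordinate. *)
Inductive domain := Space | Torus.

Definition on_domain (R : realType) (T : Type) (D : domain)
    (f : 'rV[R]_3 -> T) : Prop :=
  match D with
  | Space => True
  | Torus => forall (i : 'I_3) x, f (x + (2 * pi) *: delta_mx 0 i) = f x
  end.

Section vector_calculus.
Variable R : realType.

Definition coord (u : vector_field R) (j : 'I_3) : scalar_field R :=
  fun x => u x 0 j.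

Definition partial (i : 'I_3) (f : scalar_field R) : scalar_field R :=
  fun x => 'D_(delta_mx 0 i) f x.

(* The library's derivative is total, so differentiability is required
   explicitly at each order. *)
Fixpoint class_C (k : nat) (f : scalar_field R) : Prop :=
  match k with
  | 0 => continuous f
  | k'.+1 => (forall x, differentiable f x) /\
             (forall i, class_C k' (partial i f))
  end.

Definition vclass_C (k : nat) (u : vector_field R) : Prop :=
  forall j, class_C k (coord u j).

(* The indices in 'I_3 are added modulo 3, which gives the components of cross
   and curl by cyclic permutation. *)
Definition cross (a b : 'rV[R]_3) : 'rV[R]_3 :=
  \row_(i < 3) (a 0 (i + 1) * b 0 (i + 2) - a 0 (i + 2) * b 0 (i + 1)).

Definition curl (u : vector_field R) : vector_field R := fun x =>
  \row_(i < 3) (partial (i + 1) (coord u (i + 2)) x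
                - partial (i + 2) (coord u (i + 1)) x).

Definition divergence (u : vector_field R) : scalar_field R := fun x =>
  \sum_(i < 3) partial i (coord u i) x.

Definition grad (p : scalar_field R) : vector_field R := fun x =>
  \row_(i < 3) partial i p x.

Definition laplacian (u : vector_field R) : vector_field R := fun x =>
  \row_(j < 3) \sum_(i < 3) partial i (partial i (coord u j)) x.

Definition beltrami (D : domain) (lambda : R) : set (vector_field R) :=
  [set u | [/\ on_domain D u, vclass_C 1 u,
               forall x, curl u x = lambda *: u x &
               forall x, divergence u x = 0]].

Definition time_derivative (u : R -> vector_field R) (t : R) : vector_field R :=
  fun x => derive1 (fun s => u s x) t.

Definition jointly_continuous (W : topologicalType)
    (g : R -> 'rV[R]_3 -> W) : Prop :=
  {within [set z : R * 'rV[R]_3 | 0 <= z.1], continuous (fun z => g z.1 z.2)}.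

(* C^1 in time and C^2 in space, on [0, +oo[ times the domain. The time
   derivative is two-sided also at t = 0, which is more than the one-sided
   differentiability needed there. *)
Definition classical_field (D : domain) (u : R -> vector_field R) : Prop :=
  [/\ forall t, 0 <= t -> on_domain D (u t),
      forall t, 0 <= t -> vclass_C 2 (u t),
      forall t x, 0 <= t -> derivable (fun s => u s x) t 1 &
      [/\ jointly_continuous u,
          jointly_continuous (time_derivative u),
          forall i j, jointly_continuous (fun t => partial i (coord (u t) j)) &
          forall i k j, jointly_continuous
            (fun t => partial i (partial k (coord (u t) j)))]].

Definition hall_mhd_solution (D : domain) (nu eta : R)
    (u B : R -> vector_field R) (p : R -> scalar_field R) : Prop :=
  [/\ classical_field D u,
      classical_field D B,
      forall t, 0 <= t -> on_domain D (p t) /\ class_C 1 (p t) &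
      forall t x, 0 <= t ->
        let omega := curl (u t) in
        let J := curl (B t) in
        [/\ time_derivative u t x + cross (omega x) (u t x) + grad (p t) x
              - nu *: laplacian (u t) x = cross (J x) (B t x),
            time_derivative B t x + curl (fun y => cross (B t y) (u t y)) x
              + curl (fun y => cross (J y) (B t y)) x
              - eta *: laplacian (B t) x = 0,
            divergence (u t) x = 0 &
            divergence (B t) x = 0]].

End vector_calculus.

(* Main.v *)
Require Import Defs.
From HB Require Import structures.
From mathcomp Require Import all_boot all_order all_algebra.
From mathcomp Require Import all_classical all_reals all_analysis.
From mathcomp Require Import ring lra.

Import Order.TTheory GRing.Theory Num.Theory.
Import numFieldNormedType.Exports.

Local Open Scope classical_set_scope.
Local Open Scope ring_scope.

(** Put [l = (alpha + beta) / 2] and [d = (alpha - beta) / 2]. On the span of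
    [u0] and [B0] the curl acts as [l + N], where [N u0 = d u0 - B0],
    [N B0 = u0 - d B0] and [N ^ 2 = d ^ 2 - 1]. For divergence-free fields the
    Laplacian is [- curl curl], so the heat flow is [exp (- nu t (l + N) ^ 2)],
    whose coefficients on [1] and [N] are hyperbolic, polynomial or trigonometric
    according to the sign of [d ^ 2 - 1]. This flow preserves the two given
    relations, which make all nonlinear terms cancel with zero pressure.

    The data are only assumed [C^1], so [C^2] regularity has to be proved. For
    divergence-free [f] with [curl curl f = q], take [s = max (1 - |y|^2) 0],
    [phi = s^2] and [psi = s^3 / 6], so that [grad psi = - y phi]. Integration by
    parts gives
      [d/de (int phi(y) f(x + e y) dy) = - e (int psi(y) q(x + e y) dy)],
    hence [f(x) (int phi)] is [int phi(y) f(x + y) dy] plus the integral over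
    [0 <= e <= 1] of [e (int psi(y) q(x + e y) dy)]. One derivative in [x] can be
    moved onto the kernels, absorbing the factor [e], which shows that the partial
    derivatives of [f] are [C^1] when [f] and [q] are. *)

Local Notation component := Defs.coord.

(** * Integrals depending on a parameter *)

Section continuous_functions.
Context {R : realType} {T : topologicalType}.

Lemma continuous_cstfun {U : topologicalType} (a : U) :
  continuous (fun _ : T => a).
Proof. by move=> x; exact: cvg_cst. Qed.

Lemma continuous_compose {U V : topologicalType} (g : U -> V) (f : T -> U) :
  continuous g -> continuous f -> continuous (fun x => g (f x)).
Proof. by move=> cg cf x; apply: continuous_comp; [exact: cf|exact: cg]. Qed.

Lemma continuous_pairing {U V : topologicalType} (f : T -> U) (g : T -> V) :
  continuous f -> continuous g -> continuous (fun x => (f x, g x)).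
Proof. by move=> cf cg x; apply: cvg_pair; [exact: cf|exact: cg]. Qed.

Lemma continuous_identity : continuous (fun x : T => x).
Proof. by move=> x; exact: cvg_id. Qed.

Lemma continuous_fst {U : topologicalType} :
  continuous (fun p : T * U => p.1).
Proof. by move=> x; exact: cvg_fst. Qed.

Lemma continuous_snd {U : topologicalType} :
  continuous (fun p : T * U => p.2).
Proof. by move=> x; exact: cvg_snd. Qed.

Context {V : normedModType R}.

Lemma continuous_add (f g : T -> V) :
  continuous f -> continuous g -> continuous (fun x => f x + g x).
Proof. by move=> cf cg x; apply: (cvgD (cf x) (cg x)). Qed.

Lemma continuous_sub (f g : T -> V) :
  continuous f -> continuous g -> continuous (fun x => f x - g x).
Proof. by move=> cf cg x; apply: (cvgB (cf x) (cg x)). Qed.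

Lemma continuous_scale (f : T -> R) (g : T -> V) :
  continuous f -> continuous g -> continuous (fun x => f x *: g x).
Proof. by move=> cf cg x; apply: (cvgZ (cf x) (cg x)). Qed.

Lemma continuous_sum {I : Type} (r : seq I) (f : I -> T -> V) :
  (forall i, continuous (f i)) -> continuous (fun x => \sum_(i <- r) f i x).
Proof.
move=> cf; elim: r => [|i r IH].
  under eq_fun do rewrite big_nil.
  exact: continuous_cstfun.
by under eq_fun do rewrite big_cons; exact: continuous_add.
Qed.

Lemma continuous_mul (f g : T -> R) :
  continuous f -> continuous g -> continuous (fun x => f x * g x).
Proof. by move=> cf cg x; apply: (cvgM (cf x) (cg x)). Qed.

End continuous_functions.

Section sup_bounded_functionals.
Context {R : realType} {Y : topologicalType}.

(** Isolates what parameter integrals require of an integral, so that continuity and differentiation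
    under the sign are proved once and serve both the interval and the cube. In both uses [c] is the
    volume of [K]. *)
Definition sup_bounded_linear (K : set Y) (c : R) (L : (Y -> R) -> R) : Prop :=
  [/\ forall F G : Y -> R, continuous F -> continuous G ->
        L (fun y => F y + G y) = L F + L G,
      forall a (F : Y -> R), continuous F -> L (fun y => a * F y) = a * L F &
      forall (F : Y -> R) M, continuous F -> (forall y, K y -> `|F y| <= M) ->
        `|L F| <= c * M].

Context {K : set Y} {c : R} {L : (Y -> R) -> R}.
Hypotheses (cK : compact K) (Lbl : sup_bounded_linear K c L).

Lemma sup_bounded_linear0 : L (fun=> 0) = 0.
Proof.
have [_ LZ _] := Lbl.
rewrite -[RHS](mul0r (L (fun=> 0))) -LZ; last exact: continuous_cstfun.
by congr L; apply/funext => y; rewrite mul0r.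
Qed.

Lemma sup_bounded_linearB (F G : Y -> R) : continuous F -> continuous G ->
  L (fun y => F y - G y) = L F - L G.
Proof.
move=> cF cG; have [LD LZ _] := Lbl.
rewrite -[in RHS]mulN1r -LZ// -LD//; last first.
  by apply: continuous_mul => //; exact: continuous_cstfun.
by congr L; apply/funext => y; rewrite mulN1r.
Qed.

(** A tube argument: joint continuity gives a product neighbourhood around each [(z0, y)], and
    compactness of [K] makes the neighbourhood of [z0] uniform in [y]. *)
Lemma compact_near_uniform {T : topologicalType} {F : T * Y -> R} (z0 : T) :
  continuous F -> forall e : R, 0 < e ->
  \forall z \near z0, forall y, K y -> `|F (z, y) - F (z0, y)| < e.
Proof.
move=> cF e e0.
have /compact_near_coveringP/(_ T (nbhs z0)
  (fun z y => `|F (z, y) - F (z0, y)| < e)) := cK; apply.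
move=> y Ky; have e20 : 0 < e / 2 by rewrite divr_gt0.
have /cvgrPdist_lt/(_ _ e20) [[A B] /= [Az Bz] AB] := cF (z0, y).
exists (B, A); first by split.
move=> [y' z'] /= [By' Az'].
have h1 := AB (z', y') (conj Az' By').
have h2 := AB (z0, y') (conj (nbhs_singleton Az) By').
rewrite /= in h1 h2.
have -> : F (z', y') - F (z0, y') =
  (F (z0, y) - F (z0, y')) - (F (z0, y) - F (z', y')) by ring.
by rewrite (le_lt_trans (ler_normB _ _))// [ltRHS](splitr e) ltrD.
Qed.

Lemma continuous_slice {T U V : topologicalType} (F : T * U -> V) (z : T) :
  continuous F -> continuous (fun y => F (z, y)).
Proof.
move=> cF; apply: (continuous_compose _ (fun y => (z, y))) => //.
by apply: continuous_pairing; [exact: continuous_cstfun|exact: continuous_identity].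
Qed.

Lemma sup_bounded_linear_continuous {T : topologicalType} (F : T * Y -> R) :
  continuous F -> continuous (fun z => L (fun y => F (z, y))).
Proof.
move=> cF z0; apply/cvgrPdist_lt => e e0.
have [_ _ Lb] := Lbl.
(* The divisor is positive whatever the sign of [c], and [c] times this tolerance stays below
   [e]. *)
have d0 : 0 < e / (`|c| + 1) by rewrite divr_gt0// ltr_wpDl.
near=> z.
rewrite -sup_bounded_linearB; [|exact: continuous_slice..].
rewrite (@le_lt_trans _ _ (c * (e / (`|c| + 1))))//.
  apply: Lb.
    by apply: continuous_sub; exact: continuous_slice.
  move=> y Ky; rewrite distrC ltW//; move: y Ky; near: z.
  exact: compact_near_uniform.
rewrite mulrCA -[ltRHS]mulr1 ltr_pM2l// ltr_pdivrMr ?ltr_wpDl// mul1r.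
by rewrite (le_lt_trans (ler_norm _))// ltrDl.
Unshelve. all: by end_near. Qed.

End sup_bounded_functionals.

Lemma is_derive_cvgP {R : realType} {V W : normedModType R} (f : V -> W) (z v : V) (d : W) :
  is_derive z v f d <->
  (h^-1 *: (f (h *: v + z) - f z)) @[h --> (0 : R)^'] --> d.
Proof.
split=> [[dfz <-]|cd]; first exact: dfz.
apply: DeriveDef; first by apply/cvg_ex; exists d.
exact: cvg_lim.
Qed.

Section directional_derivatives.
Context {R : realType} {V : normedModType R}.

Lemma is_derive_line {W : normedModType R} (f : V -> W) (z v : V) (t : R) d :
  is_derive (t *: v + z) v f d -> is_derive t 1 (fun s : R => f (s *: v + z)) d.
Proof.
move/is_derive_cvgP => cd; apply/is_derive_cvgP.
rewrite (_ : (fun h => _) =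
  (fun h : R => h^-1 *: (f (h *: v + (t *: v + z)) - f (t *: v + z))))//.
by apply/funext => h; rewrite [h%:A]mulr1 scalerDl addrA.
Qed.

(** The mean value theorem along the line through [z]. Bounding [s] by [h] in absolute value treats
    both signs of [h] at once and localises the intermediate point as [h] tends to 0. *)
Lemma line_mean_value (f d : V -> R) (v : V) :
  (forall z, is_derive z v f (d z)) -> forall z (h : R),
  exists2 s, `|s| <= `|h| & f (h *: v + z) - f z = h * d (s *: v + z).
Proof.
move=> fd z h; pose g (s : R) := f (s *: v + z).
have dg (s : R) : is_derive s 1 g (d (s *: v + z)) by exact: is_derive_line.
have cg (a b : R) : {within `[a, b], continuous g}.
  by apply: derivable_within_continuous => s _; exact: (@ex_derive _ _ _ _ _ _ _ (dg s)).
have g0 : f z = g 0 by rewrite /g scale0r add0r.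
have [h0|h0] := leP 0 h.
- have [s] := MVT_segment h0 (fun s _ => dg s) (cg _ _).
  rewrite in_itv /= => /andP[s0 sh] e; exists s; first by rewrite !ger0_norm.
  by rewrite g0 e subr0 mulrC.
- have [s] := MVT_segment (ltW h0) (fun s _ => dg s) (cg _ _).
  rewrite in_itv /= => /andP[s0 sh] e; exists s.
    by rewrite !ler0_norm ?lerN2// ltW.
  by rewrite g0 -opprB e sub0r mulrN opprK mulrC.
Qed.

End directional_derivatives.

Section differentiation_under_functional.
Context {R : realType} {Y : topologicalType} {V : normedModType R}.
Context {K : set Y} {c : R} {L : (Y -> R) -> R}.
Hypotheses (cK : compact K) (Lbl : sup_bounded_linear K c L).

(** By the mean value theorem the difference quotient at [y] is a value of [D] at an intermediate
    point [s *: v + z]. This [s] depends on [y] but is bounded by [h], so uniformity over [K] makes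
    the error small in sup norm before [L] is applied. *)
Lemma is_derive_sup_bounded_linear (F D : V * Y -> R) (v : V) :
  continuous F -> continuous D ->
  (forall z y, is_derive z v (fun z => F (z, y)) (D (z, y))) ->
  forall z, is_derive z v (fun z => L (fun y => F (z, y))) (L (fun y => D (z, y))).
Proof.
move=> cF cD dF z; apply/is_derive_cvgP.
have [_ LZ Lb] := Lbl.
apply/cvgrPdist_lt => e e0.
have d0 : 0 < e / (`|c| + 1) by rewrite divr_gt0// ltr_wpDl.
have cD' : continuous (fun p : R * Y => D (p.1 *: v + z, p.2)).
  apply: (continuous_compose D) => //; apply: continuous_pairing; last exact: continuous_snd.
  apply: continuous_add; last exact: continuous_cstfun.
  apply: continuous_scale; [exact: continuous_fst|exact: continuous_cstfun].
have /nbhs_ballP[r /= r0 Dr] := compact_near_uniform cK 0 cD' _ d0.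
near=> h.
have hr : `|h| < r.
  by near: h; exact: dnbhs0_lt.
rewrite /= -(sup_bounded_linearB Lbl); [|exact: continuous_slice..].
rewrite /GRing.scale /= -LZ; last by apply: continuous_sub; exact: continuous_slice.
rewrite -(sup_bounded_linearB Lbl); [|exact: continuous_slice|]; last first.
  apply: continuous_mul; first exact: continuous_cstfun.
  by apply: continuous_sub; exact: continuous_slice.
rewrite (@le_lt_trans _ _ (c * (e / (`|c| + 1))))//; last first.
  rewrite mulrCA -[ltRHS]mulr1 ltr_pM2l// ltr_pdivrMr ?ltr_wpDl// mul1r.
  by rewrite (le_lt_trans (ler_norm _))// ltrDl.
apply: Lb.
  apply: continuous_sub; first exact: continuous_slice.
  apply: continuous_mul; first exact: continuous_cstfun.
  by apply: continuous_sub; exact: continuous_slice.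
move=> y Ky.
have [s sh /= ->] := line_mean_value _ _ v (dF^~ y) z h.
have h0 : h != 0 by near: h; exact: nbhs_dnbhs_neq.
rewrite mulKf// distrC ltW//.
have := Dr s; rewrite /= scale0r add0r; apply => //.
by rewrite /ball /= sub0r normrN (le_lt_trans sh).
Unshelve. all: by end_near. Qed.

End differentiation_under_functional.

(** * Integrals over an interval and the fundamental theorem of calculus *)

Section interval_integral.
Context {R : realType}.

Definition interval_integral (a b : R) (F : R -> R) : R :=
  \int[lebesgue_measure]_(s in `[a, b]) F s.

Lemma continuous_integrable_itv (a b : R) (F : R -> R) : continuous F ->
  lebesgue_measure.-integrable `[a, b] (EFin \o F).
Proof.
move=> cF; apply: continuous_compact_integrable; first exact: segment_compact.
exact: continuous_subspaceT.
Qed.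

Lemma interval_integral_sup_bounded (a b : R) : a <= b ->
  sup_bounded_linear `[a, b]%classic (b - a) (interval_integral a b).
Proof.
move=> ab; split.
- by move=> F G cF cG; rewrite /interval_integral RintegralD//;
    exact: continuous_integrable_itv.
- by move=> r F cF; rewrite /interval_integral RintegralZl//;
    exact: continuous_integrable_itv.
- move=> F M cF FM.
  have iF := continuous_integrable_itv a b F cF.
  apply: (le_trans (le_normr_Rintegral _ iF)) => //.
  have -> : (b - a) * M = \int[lebesgue_measure]_(s in `[a, b]) M.
    rewrite Rintegral_cst//= lebesgue_measure_itv/= lte_fin mulrC.
    by move: ab; rewrite le_eqVlt => /predU1P[->|->//]; rewrite ltxx subrr.
  apply: le_Rintegral => //.
  + apply: (continuous_integrable_itv a b (fun s => `|F s|)) => s.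
    by apply: (@cvg_norm _ _ _ _ _ F); exact: cF.
  + by apply: continuous_integrable_itv; exact: continuous_cstfun.
Qed.

Lemma interval_integral_derive (a b : R) (F f : R -> R) : a < b ->
  continuous F -> continuous f ->
  (forall s, s \in `]a, b[ -> is_derive s 1 F (f s)) ->
  interval_integral a b f = F b - F a.
Proof.
move=> ab cF cf dF; rewrite /interval_integral /Rintegral.
rewrite (@continuous_FTC2 _ f F)//.
- exact: continuous_subspaceT.
- split.
  + by move=> s /dF df; exact: (@ex_derive _ _ _ _ _ _ _ df).
  + by apply: cvg_at_right_filter; exact: cF.
  + by apply: cvg_at_left_filter; exact: cF.
- by move=> s /dF df; rewrite derive1E; exact: (@derive_val _ _ _ _ _ _ _ df).
Qed.

(** The interval of half-width 1/2 has length 1, so [m] passes through without a factor and the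
    bound can be iterated over the coordinates. *)
Lemma interval_integral_ge_half (F : R -> R) (m : R) : continuous F ->
  (forall s, `|s| <= 1 -> 0 <= F s) ->
  (forall s, `|s| <= 1 / 2 -> m <= F s) ->
  m <= interval_integral (-1) 1 F.
Proof.
move=> cF F0 Fm.
have iF := continuous_integrable_itv _ _ F cF.
have -> : m = \int[lebesgue_measure]_(s in `[(- (1 / 2) : R), 1 / 2]) m.
  rewrite Rintegral_cst//= lebesgue_measure_itv/= lte_fin ifT; last by lra.
  rewrite /=; lra.
apply: (@le_trans _ _
  (\int[lebesgue_measure]_(s in `[(- (1 / 2) : R), 1 / 2]) F s)).
  apply: le_Rintegral => //.
  + by apply: continuous_integrable_itv; exact: continuous_cstfun.
  + by move=> s /=; rewrite in_itv/= -ler_norml; exact: Fm.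
rewrite /interval_integral /Rintegral fine_le//.
- exact: integrable_fin_num.
- exact: integrable_fin_num.
apply: ge0_subset_integral => //.
- by case/integrableP : (iF (-1) 1).
- by move=> s /=; rewrite in_itv/= -ler_norml lee_fin; exact: F0.
- by move=> s /=; rewrite !in_itv/= => /andP[? ?]; apply/andP; split; lra.
Qed.

End interval_integral.

(** * Iterated integrals over the cube *)

Section cube_integral.
Context {R : realType} {n : nat}.
Implicit Types (F : 'rV[R]_n -> R) (i j : 'I_n).

Definition unit_cube : set 'rV[R]_n := [set y | forall i, `|y 0 i| <= 1].

Definition set_coord i (s : R) (y : 'rV[R]_n) : 'rV[R]_n :=
  y + (s - y 0 i) *: delta_mx 0 i.

(** Integrates out coordinate [i] but keeps the ambient space: the result is constant along that
    coordinate. Iterating therefore involves no change of dimension. *)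
Definition slice_integral i F (y : 'rV[R]_n) : R :=
  interval_integral (-1) 1 (fun s => F (set_coord i s y)).

Definition iterated_integral (r : seq 'I_n) F := foldr slice_integral F r.

(** The value is the same at every base point, all coordinates having been integrated out; 0 is a
    convenient point of the cube. *)
Definition cube_integral F : R := iterated_integral (enum 'I_n) F 0.

Definition vanishes_on_faces j F :=
  forall y, unit_cube y -> `|y 0 j| = 1 -> F y = 0.

Lemma unit_cube_compact : compact unit_cube.
Proof.
have := @rV_compact R n (fun=> `[-1, 1]%classic) (fun=> @segment_compact _ _ _).
congr compact.
by apply/seteqP; split => y yK i; move: (yK i); rewrite /= in_itv/= ler_norml.
Qed.

Lemma set_coordE i s y j : set_coord i s y 0 j = if j == i then s else y 0 j.
Proof.
rewrite !mxE eqxx/=; case: eqVneq => [->|_]; first by rewrite mulr1 subrKC.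
by rewrite mulr0 addr0.
Qed.

Lemma unit_cube_set_coord i s y :
  unit_cube y -> `|s| <= 1 -> unit_cube (set_coord i s y).
Proof. by move=> yK s1 j; rewrite set_coordE; case: ifP. Qed.

Lemma continuous_set_coord i :
  continuous (fun p : 'rV[R]_n * R => set_coord i p.2 p.1).
Proof.
apply: continuous_add; first exact: continuous_fst.
apply: continuous_scale; last exact: continuous_cstfun.
apply: continuous_sub; first exact: continuous_snd.
apply: (continuous_compose (fun y : 'rV[R]_n => y 0 i)).
  exact: coord_continuous.
exact: continuous_fst.
Qed.

Lemma continuous_comp_set_coord i F : continuous F ->
  continuous (fun p : 'rV[R]_n * R => F (set_coord i p.2 p.1)).
Proof.
by move=> cF; apply: (continuous_compose F) => //; exact: continuous_set_coord.
Qed.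

Lemma continuous_line i F y : continuous F ->
  continuous (fun s => F (set_coord i s y)).
Proof. by move=> cF; exact: (continuous_slice _ y (continuous_comp_set_coord i F cF)). Qed.

Let interval_integral_bl := @interval_integral_sup_bounded R (-1) 1 (le_trans (lerN10 _) ler01).

Lemma continuous_slice_integral i F :
  continuous F -> continuous (slice_integral i F).
Proof.
move=> /(continuous_comp_set_coord i).
exact: (sup_bounded_linear_continuous (@segment_compact _ _ _)
  interval_integral_bl (fun p => F (set_coord i p.2 p.1))).
Qed.

Lemma continuous_iterated_integral r F :
  continuous F -> continuous (iterated_integral r F).
Proof. by move=> cF; elim: r => //= i r; exact: continuous_slice_integral. Qed.

Lemma iterated_integralD r F G : continuous F -> continuous G ->
  iterated_integral r (fun y => F y + G y) =
  fun y => iterated_integral r F y + iterated_integral r G y.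
Proof.
move=> cF cG; elim: r => //= i r ->; apply/funext => y.
by case: interval_integral_bl => + _ _; apply; apply: continuous_line;
  exact: continuous_iterated_integral.
Qed.

Lemma iterated_integralZ r a F : continuous F ->
  iterated_integral r (fun y => a * F y) =
  fun y => a * iterated_integral r F y.
Proof.
move=> cF; elim: r => //= i r ->; apply/funext => y.
by case: interval_integral_bl => _ + _; apply; apply: continuous_line;
  exact: continuous_iterated_integral.
Qed.

Lemma norm_iterated_integral r F M : continuous F ->
  (forall y, unit_cube y -> `|F y| <= M) ->
  forall y, unit_cube y -> `|iterated_integral r F y| <= 2 ^+ size r * M.
Proof.
move=> cF FM; elim: r => [|i r IH] y yK; first by rewrite mul1r FM.
rewrite exprS -mulrA; case: interval_integral_bl => _ _.
rewrite (_ : 1 - -1 = 2); last by rewrite opprK.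
apply; first by apply: continuous_line; exact: continuous_iterated_integral.
move=> s; rewrite /= in_itv/= -ler_norml => s1.
by apply: IH; exact: unit_cube_set_coord.
Qed.

Lemma cube_integral_sup_bounded :
  sup_bounded_linear unit_cube (2 ^+ n) cube_integral.
Proof.
split.
- by move=> F G cF cG; rewrite /cube_integral iterated_integralD.
- by move=> a F cF; rewrite /cube_integral iterated_integralZ.
- move=> F M cF FM; have := norm_iterated_integral (enum 'I_n) F M cF FM 0.
  by rewrite size_enum_ord; apply => i; rewrite mxE normr0.
Qed.

(** For [i] different from [j], moving along [delta_mx 0 j] commutes with [set_coord i], so this is
    differentiation under the interval integral. *)
Lemma is_derive_slice_integral i j F D : i != j -> continuous F -> continuous D ->
  (forall y, is_derive y (delta_mx 0 j) F (D y)) ->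
  forall y, is_derive y (delta_mx 0 j) (slice_integral i F) (slice_integral i D y).
Proof.
move=> ij cF cD dF; apply: (is_derive_sup_bounded_linear (@segment_compact _ _ _)
  interval_integral_bl (fun p => F (set_coord i p.2 p.1))
  (fun p => D (set_coord i p.2 p.1))); try exact: continuous_comp_set_coord.
move=> y s /=; apply/is_derive_cvgP.
have /is_derive_cvgP := dF (set_coord i s y); apply: cvg_trans.
apply: near_eq_cvg; near=> h; congr (h^-1 *: (F _ - _)).
apply/rowP => k; rewrite set_coordE 2!mxE set_coordE.
case: eqVneq => [->|_]; last by rewrite !mxE.
by rewrite !mxE (negbTE ij) andbF mulr0 add0r.
Unshelve. all: by end_near. Qed.

Lemma is_derive_iterated_integral r j F D : j \notin r ->
  continuous F -> continuous D ->
  (forall y, is_derive y (delta_mx 0 j) F (D y)) ->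
  forall y, is_derive y (delta_mx 0 j) (iterated_integral r F)
    (iterated_integral r D y).
Proof.
move=> + cF cD dF; elim: r => //= i r IH; rewrite inE negb_or => /andP[ji jr].
apply: is_derive_slice_integral; [by rewrite eq_sym|exact: continuous_iterated_integral..|].
exact: IH.
Qed.

Lemma vanishes_on_faces_iterated_integral r j F : j \notin r -> continuous F ->
  vanishes_on_faces j F -> vanishes_on_faces j (iterated_integral r F).
Proof.
move=> + cF F0; elim: r => //= i r IH; rewrite inE negb_or => /andP[ji jr].
move=> y yK yj.
(* The integrand vanishes on the slice, so the sup estimate with [M = 0] forces the integral to be
   0. *)
apply/eqP; rewrite -normr_le0 -(mulr0 (1 - -1)).
case: interval_integral_bl => _ _; apply.
  by apply: continuous_line; exact: continuous_iterated_integral.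
move=> s; rewrite /= in_itv/= -ler_norml => s1.
rewrite IH ?normr0//; first exact: unit_cube_set_coord.
by rewrite set_coordE (negbTE ji).
Qed.

Lemma slice_integral_derive j F D : continuous F -> continuous D ->
  (forall y, is_derive y (delta_mx 0 j) F (D y)) -> vanishes_on_faces j F ->
  forall y, unit_cube y -> slice_integral j D y = 0.
Proof.
move=> cF cD dF F0 y yK; rewrite /slice_integral.
apply: etrans (interval_integral_derive (-1) 1
  (fun s => F (set_coord j s y)) _ _ _ _ _) _; last first.
- by rewrite !F0 ?subrr// ?set_coordE ?eqxx ?normrN ?normr1//;
    apply: unit_cube_set_coord; rewrite ?normrN ?normr1.
- move=> s _; apply/is_derive_cvgP.
  have /is_derive_cvgP := dF (set_coord j s y); apply: cvg_trans.
  apply: near_eq_cvg; near=> h; congr (h^-1 *: (F _ - _)).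
  apply/rowP => k; rewrite set_coordE 2!mxE set_coordE !mxE.
  by rewrite eqxx; case: (eqVneq k j) => _; rewrite /= ?mulr0 ?add0r.
- exact: continuous_line.
- exact: continuous_line.
- by rewrite (lt_trans (ltrN10 _)) ?ltr01.
Unshelve. all: by end_near. Qed.

(** A divergence theorem proved without exchanging integrals. The integrals inside that in [j]
    preserve both the derivative relation and the vanishing on the faces; the integral in [j] is
    then a difference of two boundary values, and the outer ones integrate 0. *)
Lemma cube_integral_derive j F D : continuous F -> continuous D ->
  (forall y, is_derive y (delta_mx 0 j) F (D y)) -> vanishes_on_faces j F ->
  cube_integral D = 0.
Proof.
move=> cF cD dF F0; rewrite /cube_integral.
have : j \in enum 'I_n by rewrite mem_enum.
suff H r : j \in r -> forall y, unit_cube y -> iterated_integral r D y = 0.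
  by move/H; apply => i; rewrite mxE normr0.
elim: r => //= i r IH; rewrite inE => jr y yK.
have [{}jr|jNr] := boolP (j \in r).
  apply/eqP; rewrite -normr_le0 -(mulr0 (1 - -1)).
  case: interval_integral_bl => _ _; apply.
    by apply: continuous_line; exact: continuous_iterated_integral.
  move=> s; rewrite /= in_itv/= -ler_norml => s1.
  by rewrite IH ?normr0//; exact: unit_cube_set_coord.
move: jr; rewrite (negbTE jNr) orbF => /eqP <-.
apply: (slice_integral_derive j (iterated_integral r F)) => //.
- exact: continuous_iterated_integral.
- exact: continuous_iterated_integral.
- exact: is_derive_iterated_integral.
- exact: vanishes_on_faces_iterated_integral.
Qed.

Lemma cube_integral_ge F (m : R) : continuous F ->
  (forall y, unit_cube y -> 0 <= F y) ->
  (forall y : 'rV[R]_n, (forall i, `|y 0 i| <= 1 / 2) -> m <= F y) ->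
  m <= cube_integral F.
Proof.
move=> cF F0 Fm; rewrite /cube_integral.
(* The two bounds go through the induction together: nonnegativity on the whole cube lets each
   integral be restricted to the half interval. *)
suff [_] : (forall y, unit_cube y -> 0 <= iterated_integral (enum 'I_n) F y) /\
  (forall y : 'rV[R]_n, (forall i, `|y 0 i| <= 1 / 2) -> m <= iterated_integral (enum 'I_n) F y).
  by apply => i; rewrite mxE normr0; lra.
elim: (enum 'I_n) => //= i r [IH0 IHm]; split => y yK.
- apply: Rintegral_ge0 => s; rewrite /= in_itv/= -ler_norml => s1.
  by apply: IH0; exact: unit_cube_set_coord.
- apply: interval_integral_ge_half.
  + by apply: continuous_line; exact: continuous_iterated_integral.
  + move=> s s1; apply: IH0; apply: unit_cube_set_coord => // k.
    by apply: le_trans (yK k) _; lra.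
  + by move=> s s1; apply: IHm => k; rewrite set_coordE; case: ifP.
Qed.

End cube_integral.

(** * Rules for directional derivatives, and differentiability from continuous partial
    derivatives *)

Section derivative_rules.
Context {R : realType} {V : normedModType R}.
Implicit Types (f g : V -> R) (z v : V).

Lemma is_derive_fun_eq f g z v (d e : R) : is_derive z v f d ->
  f =1 g -> d = e -> is_derive z v g e.
Proof. by move=> fd /funext <- <-. Qed.

Lemma is_derive_add f g z v (df dg : R) : is_derive z v f df ->
  is_derive z v g dg -> is_derive z v (fun x => f x + g x) (df + dg).
Proof. by move=> hf hg; exact: is_deriveD. Qed.

Lemma is_derive_mul f g z v (df dg : R) : is_derive z v f df ->
  is_derive z v g dg -> is_derive z v (fun x => f x * g x) (f z * dg + df * g z).
Proof.
move=> hf hg; apply: (is_derive_fun_eq _ _ _ _ _ _ (is_deriveM hf hg)) => //.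
by rewrite /GRing.scale /= [df * _]mulrC.
Qed.

Lemma is_derive_const (a : R) z v : is_derive z v (fun=> a) 0.
Proof. exact: is_derive_cst. Qed.

Lemma is_derive_mulC (a : R) f z v (df : R) : is_derive z v f df ->
  is_derive z v (fun x => a * f x) (a * df).
Proof.
move=> hf; apply: is_derive_fun_eq (is_derive_mul _ _ _ _ _ _ (is_derive_const a z v) hf) _ _ => //.
by rewrite mul0r addr0.
Qed.

Lemma is_derive_translate f z v (w : V) (d : R) :
  is_derive (w + z) v f d -> is_derive z v (fun x => f (w + x)) d.
Proof.
move/is_derive_cvgP => cd; apply/is_derive_cvgP; apply: cvg_trans cd.
by apply: near_eq_cvg; near=> h; rewrite addrCA.
Unshelve. all: by end_near. Qed.

Lemma is_derive_affine f z v (w : V) (a : R) : (forall x, differentiable f x) ->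
  is_derive z v (fun x => f (a *: x + w)) (a * 'D_v f (a *: z + w)).
Proof.
move=> df; pose A (x : V) := a *: x + w.
have dA : is_diff z A ( *:%R a).
  by apply: (is_diff_eq (is_diffD (is_diff_scaler a z) (is_diff_cst w z))); rewrite addr0.
have diffA : differentiable A z by case: dA.
have dfA : differentiable (f \o A) z by exact: differentiable_comp.
apply: DeriveDef; first exact: diff_derivable.
rewrite deriveE// diff_comp//.
by rewrite /= diff_val linearZ/= deriveE.
Qed.

End derivative_rules.

Section partial_derivatives.
Context {R : realType} {n : nat}.
Implicit Types (f : 'rV[R]_n -> R).

Lemma derive_partialE f (z v : 'rV[R]_n) : differentiable f z ->
  'D_v f z = \sum_i v 0 i * 'D_(delta_mx 0 i) f z.
Proof.
move=> df; rewrite deriveE// [in LHS](row_sum_delta v) linear_sum/=.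
by apply: eq_bigr => i _; rewrite linearZ/= deriveE.
Qed.

Lemma row_norm_le (v : 'rV[R]_n) (M : R) : 0 <= M ->
  (forall i, `|v 0 i| <= M) -> `|v| <= M.
Proof.
move=> M0 vM; rewrite [leLHS]/Num.norm/= mx_normrE.
by apply/bigmax_leP; split => // -[i j] _ /=; rewrite ord1.
Qed.

Lemma coord_norm_le (v : 'rV[R]_n) i : `|v 0 i| <= `|v|.
Proof.
rewrite [leRHS]/Num.norm/= mx_normrE.
by apply/bigmax_geP; right; exists (0, i).
Qed.

(** Go from [x] to [x + h] along one coordinate direction at a time and apply the mean value theorem
    on each edge; continuity of the [d i] controls the error of every edge. *)
Lemma differentiable_continuous_partials f (d : 'I_n -> 'rV[R]_n -> R) :
  (forall i x, is_derive x (delta_mx 0 i) f (d i x)) ->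
  (forall i, continuous (d i)) -> forall x, differentiable f x.
Proof.
move=> fd cd x.
pose df (h : 'rV[R]_n) := \sum_i h 0 i * d i x.
have lin_df : linear df.
  move=> a u v; rewrite /df scaler_sumr -big_split; apply: eq_bigr => i _ /=.
  by rewrite !mxE mulrDl -mulrA.
pose dfM := GRing.isLinear.Build _ _ _ _ _ lin_df.
pose dfL : {linear _ -> _} := HB.pack df dfM.
have cdf : continuous dfL.
  apply: (continuous_sum _ (fun i (h : 'rV[R]_n) => h 0 i * d i x)) => i.
  apply: continuous_mul; first exact: coord_continuous.
  exact: continuous_cstfun.
suff key : f \o shift x = cst (f x) + dfL +o_ 0 id.
  by apply/diff_locallyP; rewrite (diff_unique cdf key).
apply/eqaddoP => e e0.
pose e' := e / n.+1%:R.
have e'0 : 0 < e' by rewrite divr_gt0.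
have near_d : \forall w \near x, forall i, `|d i x - d i w| < e'.
  have near_i i : \forall w \near x, `|d i x - d i w| < e'.
    by have /cvgrPdist_lt/(_ e' e'0) := cd i x.
  exact: filter_forall near_i.
have [r /= r0 dr] := (nbhs_ballP _ _).1 near_d.
(* All intermediate points lie within [n + 1] times the norm of [h] from [x], hence in the ball of
   radius [r]. *)
have near_r : \forall h \near (0 : 'rV[R]_n), `|h| < r / n.+1%:R.
  by apply: nbhs0_lt; rewrite divr_gt0.
near=> h.
have hr : `|h| < r / n.+1%:R by near: h; exact: near_r.
(* [x + p s] is the vertex reached after the coordinate steps listed in [s]. *)
pose p (s : seq 'I_n) := \sum_(i <- s) h 0 i *: (delta_mx 0 i : 'rV[R]_n).
have step (s : seq 'I_n) : (size s <= n)%N ->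
    `|p s| <= (size s)%:R * `|h| /\
    `|f (p s + x) - f x - \sum_(i <- s) h 0 i * d i x| <= (size s)%:R * (e' * `|h|).
  elim: s => [|i s IH] sn.
    by rewrite /p !big_nil add0r !subrr !normr0 !mul0r.
  have [IHp IHf] := IH (ltnW sn).
  rewrite /p !big_cons -/(p s).
  have hi : `|h 0 i *: (delta_mx 0 i : 'rV[R]_n)| <= `|h|.
    rewrite normrZ -[leRHS]mulr1 ler_pM//; first exact: coord_norm_le.
    apply: row_norm_le => // j; rewrite !mxE.
    by case: (_ && _); rewrite ?normr1 ?normr0.
  split.
    rewrite /= -natr1 mulrDl mul1r.
    by apply: le_trans (ler_normD _ _) _; rewrite addrC lerD.
  have [t th ft] := line_mean_value f (d i) (delta_mx 0 i) (fd i) (p s + x) (h 0 i).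
  rewrite -(addrA (h 0 i *: delta_mx 0 i) (p s) x).
  have -> : f (h 0 i *: delta_mx 0 i + (p s + x)) - f x -
      (h 0 i * d i x + \sum_(j <- s) h 0 j * d j x) =
    (f (p s + x) - f x - \sum_(j <- s) h 0 j * d j x) +
    h 0 i * (d i (t *: delta_mx 0 i + (p s + x)) - d i x).
    by move: ft => /eqP; rewrite subr_eq => /eqP ->; ring.
  rewrite /= -natr1 mulrDl mul1r (le_trans (ler_normD _ _))// lerD//.
  rewrite normrM mulrC ler_pM//; last exact: coord_norm_le.
  rewrite distrC ltW//; apply: dr; rewrite /= -ball_normE /=.
  rewrite distrC addrA addrK.
  have ti : `|t *: (delta_mx 0 i : 'rV[R]_n)| <= `|h|.
    rewrite normrZ -[leRHS]mulr1 ler_pM//; first exact: le_trans th (coord_norm_le _ _).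
    apply: row_norm_le => // j; rewrite !mxE.
    by case: (_ && _); rewrite ?normr1 ?normr0.
  apply: le_lt_trans (ler_normD _ _) _.
  apply: (@le_lt_trans _ _ (n.+1%:R * `|h|)).
    rewrite -natr1 mulrDl mul1r addrC lerD//; apply: le_trans IHp _.
    by rewrite ler_wpM2r// ler_nat ltnW.
  by rewrite mulrC -ltr_pdivlMr.
have sz : size (index_enum 'I_n) = n by rewrite -[RHS](card_ord n) cardT enumT.
have [_] := step (index_enum 'I_n) (eq_leq sz).
rewrite /p -row_sum_delta sz => H.
rewrite /= -[X in `|X|]/(f (h + x) - (f x + df h)) opprD addrA.
apply: le_trans H _; rewrite /e' mulrA.
rewrite ler_wpM2r// mulrCA -[leRHS]mulr1 ler_pM2l// ler_pdivrMr// mul1r ler_nat.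
exact: leqnSn.
Unshelve. all: by end_near. Qed.

End partial_derivatives.

(** * Integrals of a field against a kernel, with a dilation factor *)

Section cube_convolution.
Context {R : realType}.
Local Notation vec := 'rV[R]_3.
Implicit Types (k h : vec -> R) (x : vec) (e : R) (i j : 'I_3).

(* Locked so that unification does not unfold the iterated integral. *)
Fact cube_conv_key : unit. Proof. exact: tt. Qed.
Definition cube_conv k h e x : R := locked_with cube_conv_key
  (fun k h e x => cube_integral (fun y => k y * h (e *: y + x))) k h e x.

Lemma cube_convE : cube_conv =
  fun k h e x => cube_integral (fun y => k y * h (e *: y + x)).
Proof. by rewrite /cube_conv unlock. Qed.

Lemma class_C1_continuous h : class_C 1 h -> continuous h.
Proof. by move=> [dh _] x; exact: differentiable_continuous. Qed.

Lemma continuous_partial h i : class_C 1 h -> continuous (partial i h).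
Proof. by case. Qed.

Lemma class_C1_is_derive h i x : class_C 1 h ->
  is_derive x (delta_mx 0 i) h (partial i h x).
Proof. by move=> [dh _]; apply: DeriveDef => //; exact: diff_derivable. Qed.

Lemma continuous_conv_integrand k h : continuous k -> continuous h ->
  continuous (fun p : (R * vec) * vec => k p.2 * h (p.1.1 *: p.2 + p.1.2)).
Proof.
move=> ck ch; apply: continuous_mul.
  by apply: (continuous_compose k) => //; exact: continuous_snd.
apply: (continuous_compose h) => //; apply: continuous_add.
  apply: continuous_scale; last exact: continuous_snd.
  by apply: (continuous_compose fst); exact: continuous_fst.
by apply: (continuous_compose snd); [exact: continuous_snd|exact: continuous_fst].
Qed.

Lemma continuous_cube_conv k h : continuous k -> continuous h ->
  continuous (fun p : R * vec => cube_conv k h p.1 p.2).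
Proof.
move=> ck ch; rewrite cube_convE.
exact: (sup_bounded_linear_continuous unit_cube_compact
  cube_integral_sup_bounded _ (continuous_conv_integrand _ _ ck ch)).
Qed.

Lemma continuous_integrand k h e x : continuous k -> continuous h ->
  continuous (fun y => k y * h (e *: y + x)).
Proof.
move=> ck ch.
exact: (continuous_slice _ (e, x) (continuous_conv_integrand _ _ ck ch)).
Qed.

Lemma cube_convDr k h1 h2 e x : continuous k -> continuous h1 -> continuous h2 ->
  cube_conv k (fun z => h1 z + h2 z) e x = cube_conv k h1 e x + cube_conv k h2 e x.
Proof.
move=> ck c1 c2; have [+ _ _] := @cube_integral_sup_bounded R 3.
rewrite cube_convE => <-; [|exact: continuous_integrand..].
by congr cube_integral; apply/funext => y; rewrite mulrDr.
Qed.

Lemma cube_convZl a k h e x : continuous k -> continuous h ->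
  cube_conv (fun y => a * k y) h e x = a * cube_conv k h e x.
Proof.
move=> ck ch; have [_ + _] := @cube_integral_sup_bounded R 3.
rewrite cube_convE => <-; last exact: continuous_integrand.
by congr cube_integral; apply/funext => y; rewrite mulrA.
Qed.

Lemma cube_convZr a k h e x : continuous k -> continuous h ->
  cube_conv k (fun z => a * h z) e x = a * cube_conv k h e x.
Proof.
move=> ck ch; have [_ + _] := @cube_integral_sup_bounded R 3.
rewrite cube_convE => <-; last exact: continuous_integrand.
by congr cube_integral; apply/funext => y; rewrite mulrCA.
Qed.

(** The dilation collapses at [e = 0], which recovers point values from integrals. *)
Lemma cube_conv0 k h x : continuous k ->
  cube_conv k h 0 x = h x * cube_integral k.
Proof.
move=> ck; have [_ LZ _] := @cube_integral_sup_bounded R 3; rewrite cube_convE -LZ//.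
by congr cube_integral; apply/funext => y; rewrite scale0r add0r mulrC.
Qed.

Lemma is_derive_cube_conv_space k h e x i : continuous k -> class_C 1 h ->
  is_derive x (delta_mx 0 i) (cube_conv k h e) (cube_conv k (partial i h) e x).
Proof.
move=> ck h1.
have ch := class_C1_continuous _ h1; have cph := continuous_partial _ i h1.
have cF g : continuous g ->
    continuous (fun p : vec * vec => k p.2 * g (e *: p.2 + p.1)).
  move=> cg; apply: (continuous_compose
    (fun p : (R * vec) * vec => k p.2 * g (p.1.1 *: p.2 + p.1.2))
    (fun p : vec * vec => ((e, p.1), p.2)) (continuous_conv_integrand _ _ ck cg)).
  apply: continuous_pairing; last exact: continuous_snd.
  by apply: continuous_pairing; [exact: continuous_cstfun|exact: continuous_fst].
rewrite cube_convE; apply: (is_derive_sup_bounded_linear unit_cube_compact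
  cube_integral_sup_bounded _ _ _ (cF _ ch) (cF _ cph)) => z y /=.
apply: is_derive_mulC; apply: is_derive_translate; exact: class_C1_is_derive.
Qed.

(** The [e]-derivative of [h (e *: y + x)] is the derivative of [h] in direction [y]; expanding it
    in coordinates puts the weights [y 0 i] on the kernel. *)
Lemma is_derive_cube_conv_scale k h e x : continuous k -> class_C 1 h ->
  is_derive e 1 (fun e => cube_conv k h e x)
    (\sum_i cube_conv (fun y => y 0 i * k y) (partial i h) e x).
Proof.
move=> ck h1; have ch := class_C1_continuous _ h1.
have cF k' g : continuous k' -> continuous g ->
    continuous (fun p : R * vec => k' p.2 * g (p.1 *: p.2 + x)).
  move=> ck' cg; apply: (continuous_compose
    (fun p : (R * vec) * vec => k' p.2 * g (p.1.1 *: p.2 + p.1.2))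
    (fun p : R * vec => ((p.1, x), p.2)) (continuous_conv_integrand _ _ ck' cg)).
  apply: continuous_pairing; last exact: continuous_snd.
  by apply: continuous_pairing; [exact: continuous_fst|exact: continuous_cstfun].
have cyk i : continuous (fun y : vec => y 0 i * k y).
  by apply: continuous_mul => //; exact: coord_continuous.
have cD : continuous (fun p : R * vec =>
    \sum_i p.2 0 i * k p.2 * partial i h (p.1 *: p.2 + x)).
  apply: (continuous_sum _ (fun i (p : R * vec) =>
    p.2 0 i * k p.2 * partial i h (p.1 *: p.2 + x))) => i.
  by apply: (cF (fun y => y 0 i * k y)); [exact: cyk|exact: continuous_partial].
have := @is_derive_sup_bounded_linear R _ R _ _ _ unit_cube_compact
  cube_integral_sup_bounded _ _ 1 (cF _ _ ck ch) cD.
move=> H; rewrite cube_convE; apply: (is_derive_fun_eq _ _ _ _ _ _ (H _ e)) => //.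
- move=> t y /=; apply: (is_derive_fun_eq _ _ _ _ _ _
    (is_derive_mulC (k y) _ _ _ _ (is_derive_line h x y t _ _))).
  + by apply: DeriveDef (erefl _); apply: diff_derivable; case: h1.
  + by [].
  + rewrite derive_partialE; last by case: h1.
    by rewrite mulr_sumr; apply: eq_bigr => i _; rewrite mulrCA mulrA.
- elim: (index_enum _) => [|i r IH].
    rewrite big_nil -[RHS](sup_bounded_linear0 (@cube_integral_sup_bounded R 3)).
    by congr cube_integral; apply/funext => y; rewrite big_nil.
  rewrite big_cons -IH; have [LD _ _] := @cube_integral_sup_bounded R 3.
  rewrite -LD.
  + by congr cube_integral; apply/funext => y; rewrite big_cons.
  + by apply: continuous_integrand; [exact: cyk|exact: continuous_partial].
  + apply: (continuous_sum r (fun (i : 'I_3) (y : vec) =>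
      y 0 i * k y * partial i h (e *: y + x))) => j.
    by apply: continuous_integrand; [exact: cyk|exact: continuous_partial].
Qed.

(** The integral of the [j]-derivative of [k y * h (e *: y + x)] vanishes. The factor [e] comes from
    the chain rule: [e] together with a derivative of [h] is traded for a derivative of the
    kernel. *)
Lemma cube_conv_by_parts k dk h e x j : continuous k -> continuous dk ->
  (forall y, is_derive y (delta_mx 0 j) k (dk y)) -> vanishes_on_faces j k ->
  class_C 1 h ->
  e * cube_conv k (partial j h) e x = - cube_conv dk h e x.
Proof.
move=> ck cdk dk_k k0 h1.
have ch := class_C1_continuous _ h1; have cph := continuous_partial _ j h1.
apply/eqP; rewrite -addr_eq0; apply/eqP; rewrite -cube_convZl//.
have [+ _ _] := @cube_integral_sup_bounded R 3.
rewrite cube_convE => <-; last exact: continuous_integrand.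
  apply: (cube_integral_derive j (fun y => k y * h (e *: y + x))).
  - exact: continuous_integrand.
  - apply: continuous_add; last exact: continuous_integrand.
    apply: (continuous_integrand (fun y => e * k y)) => //.
    by apply: continuous_mul => //; exact: continuous_cstfun.
  - move=> y; apply: (is_derive_fun_eq _ _ _ _ _ _ (is_derive_mul _ _ _ _ _ _ (dk_k y)
      (is_derive_affine h y _ x e _))) => //; first by case: h1.
    by rewrite mulrCA mulrA.
  - by move=> y yK yj; rewrite k0 ?mul0r.
apply: (continuous_integrand (fun y => e * k y)) => //.
by apply: continuous_mul => //; exact: continuous_cstfun.
Qed.

End cube_convolution.

(** * Regularity *)

Section bump_kernels.
Context {R : realType}.
Local Notation vec := 'rV[R]_3.
Implicit Types (y : vec) (i j k : 'I_3).

(** The remainder stays quadratic across the kink at 0, which makes the square of the positive part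
    differentiable there too. *)
Lemma max0_sqr_taylor (b h : R) :
  `|Num.max (b + h) 0 ^+ 2 - Num.max b 0 ^+ 2 - 2 * Num.max b 0 * h| <= h ^+ 2.
Proof.
rewrite ler_norml.
by have [b0|b0] := leP b 0; have [bh0|bh0] := leP (b + h) 0; apply/andP; split; nra.
Qed.

Lemma is_derive_max0_sqr (b : R) :
  is_derive b 1 (fun t : R => Num.max t 0 ^+ 2) (2 * Num.max b 0).
Proof.
apply/is_derive_cvgP/cvgrPdist_le => e e0.
near=> h.
have h0 : h != 0 by near: h; exact: nbhs_dnbhs_neq.
have he : `|h| <= e by near: h; exact: dnbhs0_le.
rewrite /GRing.scale /= mulr1 [h + b]addrC.
have -> : 2 * Num.max b 0 - h^-1 * (Num.max (b + h) 0 ^+ 2 - Num.max b 0 ^+ 2) =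
    - ((Num.max (b + h) 0 ^+ 2 - Num.max b 0 ^+ 2 - 2 * Num.max b 0 * h) / h).
  by field.
rewrite normrN normrM normfV.
rewrite ler_pdivrMr ?normr_gt0//; apply: le_trans (max0_sqr_taylor _ _) _.
by rewrite -real_normK ?num_real// expr2 ler_wpM2r.
Unshelve. all: by end_near. Qed.

Lemma is_derive_at_line {V : normedModType R} (f : V -> R) (z v : V) (d : R) :
  is_derive (0 : R) 1 (fun t : R => f (t *: v + z)) d -> is_derive z v f d.
Proof.
move/is_derive_cvgP => cd; apply/is_derive_cvgP; apply: cvg_trans cd.
apply: near_eq_cvg; near=> h.
by rewrite scale0r add0r addr0 [h%:A]mulr1.
Unshelve. all: by end_near. Qed.

Lemma is_derive_real_comp {V : normedModType R} (g : R -> R) (f : V -> R)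
    (z v : V) (dg df : R) : is_derive (f z) 1 g dg -> is_derive z v f df ->
  is_derive z v (fun x => g (f x)) (dg * df).
Proof.
move=> hg hf; apply: is_derive_at_line.
apply: (@is_derive1_comp _ g (fun t => f (t *: v + z))).
  by rewrite scale0r add0r.
by apply: is_derive_line; rewrite scale0r add0r.
Qed.

Lemma is_derive_coord y i j :
  is_derive y (delta_mx 0 i) (fun y => y 0 j) (i == j)%:R.
Proof.
apply/is_derive_cvgP; apply: cvg_near_cst; near=> h.
have h0 : h != 0 by near: h; exact: nbhs_dnbhs_neq.
by rewrite !mxE addrK /= eq_sym /GRing.scale /= mulKf.
Unshelve. all: by end_near. Qed.

Lemma is_derive_big_sum {V : normedModType R} {I : Type} (r : seq I)
    (f : I -> V -> R) (d : I -> R) (z v : V) :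
  (forall a, is_derive z v (f a) (d a)) ->
  is_derive z v (fun x => \sum_(a <- r) f a x) (\sum_(a <- r) d a).
Proof.
move=> fd; elim: r => [|a r IH].
  by under eq_fun do rewrite big_nil; rewrite big_nil; exact: is_derive_const.
by under eq_fun do rewrite big_cons; rewrite big_cons; exact: is_derive_add.
Qed.

Definition ball_gap y : R := 1 - \sum_i y 0 i ^+ 2.
Definition gap_pos y : R := Num.max (ball_gap y) 0.
Definition phi y : R := gap_pos y ^+ 2.
(** Equal to [gap_pos y ^+ 3 / 6], since [phi] vanishes where [ball_gap] is nonpositive; written as
    a product so that the product rule differentiates it. *)
Definition psi y : R := 6^-1 * (ball_gap y * phi y).
Definition dphi k y : R := - 4 * (y 0 k * gap_pos y).
(** The factor [- 1] is a scalar multiple rather than an opposite, the form to which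
    [is_derive_mulC] applies. *)
Definition dpsi i y : R := - 1 * (y 0 i * phi y).
Definition ddpsi i j y : R := - 1 * (y 0 i * dphi j y + (j == i)%:R * phi y).

Lemma continuous_ball_gap : continuous ball_gap.
Proof.
apply: continuous_sub; first exact: continuous_cstfun.
apply: (continuous_sum _ (fun i (y : vec) => y 0 i ^+ 2)) => i.
by apply: (continuous_mul (fun y : vec => y 0 i) (fun y : vec => y 0 i));
  exact: coord_continuous.
Qed.

Lemma continuous_gap_pos : continuous gap_pos.
Proof.
move=> y; apply: (@continuous_max _ _ ball_gap (fun=> 0)).
  exact: continuous_ball_gap.
exact: continuous_cstfun.
Qed.

Lemma continuous_phi : continuous phi.
Proof. by apply: (continuous_mul gap_pos gap_pos); exact: continuous_gap_pos. Qed.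

Lemma continuous_psi : continuous psi.
Proof.
apply: (continuous_mul (fun=> 6^-1)); first exact: continuous_cstfun.
apply: continuous_mul; [exact: continuous_ball_gap|exact: continuous_phi].
Qed.

Lemma continuous_dphi k : continuous (dphi k).
Proof.
apply: (continuous_mul (fun=> - 4)); first exact: continuous_cstfun.
apply: continuous_mul; [exact: coord_continuous|exact: continuous_gap_pos].
Qed.

Lemma continuous_dpsi k : continuous (dpsi k).
Proof.
apply: (continuous_mul (fun=> - 1)); first exact: continuous_cstfun.
apply: continuous_mul; [exact: coord_continuous|exact: continuous_phi].
Qed.

Lemma continuous_ddpsi i j : continuous (ddpsi i j).
Proof.
apply: (continuous_mul (fun=> - 1)); first exact: continuous_cstfun.
apply: continuous_add; apply: continuous_mul.
- exact: coord_continuous.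
- exact: continuous_dphi.
- exact: continuous_cstfun.
- exact: continuous_phi.
Qed.

Lemma is_derive_ball_gap y k :
  is_derive y (delta_mx 0 k) ball_gap (- 2 * y 0 k).
Proof.
have dsum := is_derive_big_sum (index_enum 'I_3) (fun i (y : vec) => y 0 i * y 0 i) _ _ _
  (fun i => is_derive_mul _ _ _ _ _ _ (is_derive_coord y k i) (is_derive_coord y k i)).
have := is_derive_add _ _ _ _ _ _ (is_derive_const 1 y (delta_mx 0 k))
  (is_derive_mulC (-1) _ _ _ _ dsum).
move=> H; apply: (is_derive_fun_eq _ _ _ _ _ _ H) => [z|].
  by rewrite mulN1r.
rewrite (bigD1 k)//= big1 ?eqxx; last first.
  by move=> i ik; rewrite eq_sym (negbTE ik) mulr0 mul0r addr0.
by rewrite mulr1n; ring.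
Qed.

Lemma is_derive_phi y k : is_derive y (delta_mx 0 k) phi (dphi k y).
Proof.
have := is_derive_real_comp _ _ _ _ _ _ (is_derive_max0_sqr (ball_gap y))
  (is_derive_ball_gap y k).
move=> H; apply: (is_derive_fun_eq _ _ _ _ _ _ H) => //.
by rewrite /dphi /gap_pos; ring.
Qed.

Lemma is_derive_psi y k : is_derive y (delta_mx 0 k) psi (dpsi k y).
Proof.
have H := is_derive_mulC 6^-1 _ _ _ _ (is_derive_mul _ _ _ _ _ _
  (is_derive_ball_gap y k) (is_derive_phi y k)).
apply: (is_derive_fun_eq _ _ _ _ _ _ H) => //.
(* Both sides vanish when [ball_gap y] is nonpositive. The product rule then gives - 2 y phi - 4 y
   phi = - 6 y phi, whence the factor [6^-1] in [psi]. *)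
have e : ball_gap y * gap_pos y = phi y.
  rewrite /phi /gap_pos; case: leP => //; first by rewrite expr2 !mulr0.
have -> : ball_gap y * dphi k y = - 4 * (y 0 k * (ball_gap y * gap_pos y)).
  by rewrite /dphi; ring.
by rewrite e /dpsi; lra.
Qed.

Lemma is_derive_dpsi y i j : is_derive y (delta_mx 0 j) (dpsi i) (ddpsi i j y).
Proof.
apply: is_derive_mulC; apply: is_derive_mul; last exact: is_derive_phi.
exact: is_derive_coord.
Qed.

(** The kernel is radial and its Hessian symmetric. This symmetry stands in for that of the second
    derivatives of the field, which are not yet available. *)
Lemma ddpsiC i j : ddpsi i j = ddpsi j i.
Proof. by apply/funext => y; rewrite /ddpsi /dphi eq_sym; case: eqVneq => [->//|_]; ring. Qed.

(** The unit ball touches a face of the cube only at the centre of that face, so 1 - |y|^2 is at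
    most 0 there. *)
Lemma gap_pos_face i y : unit_cube y -> `|y 0 i| = 1 -> gap_pos y = 0.
Proof.
move=> _ yi; apply: max_r; rewrite /ball_gap subr_le0 (bigD1 i)//=.
rewrite -[y 0 i ^+ 2]real_normK ?num_real// yi expr1n lerDl.
by apply: sumr_ge0 => k _; exact: sqr_ge0.
Qed.

Lemma phi_face i : vanishes_on_faces i phi.
Proof. by move=> y yK yi; rewrite /phi (gap_pos_face i) ?expr0n. Qed.

Lemma psi_face i : vanishes_on_faces i psi.
Proof. by move=> y yK yi; rewrite /psi (phi_face i) ?mulr0. Qed.

Lemma dpsi_face k i : vanishes_on_faces i (dpsi k).
Proof. by move=> y yK yi; rewrite /dpsi (phi_face i) ?mulr0. Qed.

Lemma ball_gap_half y : (forall i, `|y 0 i| <= 1 / 2) -> 1 / 4 <= ball_gap y.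
Proof.
move=> yh; have yi i : y 0 i ^+ 2 <= 1 / 4.
  by move: (yh i); rewrite ler_norml => /andP[? ?]; nra.
rewrite /ball_gap !big_ord_recr big_ord0 /=.
have := yi (widen_ord (leqnSn 2) (widen_ord (leqnSn 1) ord_max)).
have := yi (widen_ord (leqnSn 2) ord_max); have := yi ord_max.
lra.
Qed.

Lemma cube_integral_phi_gt0 : 0 < cube_integral phi.
Proof.
(* On the half cube [ball_gap] is at least 1 - 3/4 = 1/4, and [phi] at least its square. *)
apply: (@lt_le_trans _ _ (1 / 16)); first by lra.
apply: cube_integral_ge; first exact: continuous_phi.
- by move=> y _; exact: sqr_ge0.
- move=> y /ball_gap_half s4.
  by rewrite /phi /gap_pos max_l; nra.
Qed.

Lemma cube_integral_psi_gt0 : 0 < cube_integral psi.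
Proof.
(* 1/384 = (1/6) (1/4) (1/16). *)
apply: (@lt_le_trans _ _ (1 / 384)); first by lra.
apply: cube_integral_ge; first exact: continuous_psi.
- move=> y _; rewrite /psi /phi /gap_pos; have [s0|s0] := leP (ball_gap y) 0.
    by rewrite expr0n !mulr0.
  by rewrite !mulr_ge0// ltW.
- move=> y /ball_gap_half s4; rewrite /psi /phi /gap_pos max_l; last by lra.
  have : 1 / 16 <= ball_gap y ^+ 2 by nra.
  nra.
Qed.

End bump_kernels.

(** * Elliptic regularity for divergence-free fields *)

Section elliptic_regularity.
Context {R : realType}.
Local Notation vec := 'rV[R]_3.
Implicit Types (h : vec -> R) (x : vec) (e : R) (i j k : 'I_3).

Lemma add1_1 j : j + 1 + 1 = j + 2.
Proof. by rewrite -addrA. Qed.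

Lemma add1_2 j : j + 1 + 2 = j.
Proof. by rewrite -addrA (_ : 1 + 2 = 0) ?addr0//; exact: val_inj. Qed.

Lemma add2_1 j : j + 2 + 1 = j.
Proof. by rewrite -addrA (_ : 2 + 1 = 0) ?addr0//; exact: val_inj. Qed.

Lemma add2_2 j : j + 2 + 2 = j + 1.
Proof. by rewrite -addrA (_ : 2 + 2 = 1)//; exact: val_inj. Qed.

(** Starting the sum at an arbitrary [j] matches the cyclic indices of [curl], so one computation
    serves all three components. *)
Lemma sum_cyclic {V : nmodType} (F : 'I_3 -> V) j :
  \sum_i F i = F j + F (j + 1) + F (j + 2).
Proof.
have neq1 : j + 1 != j by case: j => [[|[|[|?]]] ?].
have neq2 : (j + 2 != j) && (j + 2 != j + 1) by case: j {neq1} => [[|[|[|?]]] ?].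
rewrite (bigD1 j)//= (bigD1 (j + 1))//= (bigD1 (j + 2))//=.
rewrite big1 ?addr0 ?addrA// => i; case/andP => /andP[].
by case: j {neq1 neq2} => [[|[|[|?]]] ?] //; case: i => [[|[|[|?]]] ?].
Qed.

Lemma class_CS m h : class_C m.+1 h -> class_C m h.
Proof.
elim: m h => [h|m IH h [dh ph]]; first exact: class_C1_continuous.
by split => // i; exact: IH.
Qed.

Lemma class_C1_partials (f : vec -> R) (d : 'I_3 -> vec -> R) :
  (forall i x, is_derive x (delta_mx 0 i) f (d i x)) ->
  (forall i, continuous (d i)) -> class_C 1 f.
Proof.
move=> fd cd; split; first exact: differentiable_continuous_partials fd cd.
move=> i; rewrite /= (_ : partial i f = d i)//; apply/funext => x.
exact: (@derive_val _ _ _ _ _ _ _ (fd i x)).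
Qed.

(* Partial derivatives are named by equations because comparing two of them by
   conversion is very slow. *)
Lemma cube_conv_psi_partial h d i e x : class_C 1 h -> d = partial i h ->
  e * cube_conv psi d e x = - cube_conv (dpsi i) h e x.
Proof.
move=> h1 ->; move: h1.
apply: cube_conv_by_parts; [exact: continuous_psi|exact: continuous_dpsi| |].
  by move=> y; exact: is_derive_psi.
exact: psi_face.
Qed.

Lemma cube_conv_dpsi_partial h d i j e x : class_C 1 h -> d = partial j h ->
  e * cube_conv (dpsi i) d e x = - cube_conv (ddpsi i j) h e x.
Proof.
move=> h1 ->; move: h1.
apply: cube_conv_by_parts; [exact: continuous_dpsi|exact: continuous_ddpsi| |].
  by move=> y; exact: is_derive_dpsi.
exact: dpsi_face.
Qed.

(** Both sides, times [e], equal minus the integral of [h] against the Hessian of [psi]. Derivative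
    indices are thus exchanged for a function that is only C^1. *)
Lemma cube_conv_dpsi_swap h di dj i j e x : class_C 1 h ->
  di = partial i h -> dj = partial j h -> e != 0 ->
  cube_conv (dpsi i) dj e x = cube_conv (dpsi j) di e x.
Proof.
move=> h1 diE djE e0; apply: (mulfI e0).
rewrite (cube_conv_dpsi_partial h dj i j e x h1 djE).
by rewrite (cube_conv_dpsi_partial h di j i e x h1 diE) ddpsiC.
Qed.

(** Identities obtained by cancelling a factor [e] hold for nonzero [e] only; continuity carries
    them to 0. *)
Lemma continuous_eq0_punctured (A : R -> R) : continuous A ->
  (forall e, e != 0 -> A e = 0) -> A 0 = 0.
Proof.
move=> cA A0; have cA0 : A e @[e --> (0 : R)^'] --> A 0.
  by apply: cvg_trans (cA 0); apply: cvg_app; exact: cvg_within.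
have : A e @[e --> (0 : R)^'] --> 0.
  apply: cvg_near_cst; near=> e; apply: A0; near: e; exact: nbhs_dnbhs_neq.
by move=> /(cvg_unique _ cA0); apply.
Unshelve. all: by end_near. Qed.

(* Integrating by parts, both sides have the same integral against every dilate
   of [psi]; let the dilation factor tend to 0. *)
Lemma partial_comm h i j x : class_C 2 h ->
  partial i (partial j h) x = partial j (partial i h) x.
Proof.
move=> /[dup] /class_CS h1 [_ h2].
have c2 a b : continuous (partial a (partial b h)).
  by apply: continuous_partial; exact: h2.
have [di diE] : exists d, d = partial i h by eexists.
have [dj djE] : exists d, d = partial j h by eexists.
have [dij dijE] : exists d, d = partial i dj by eexists.
have [dji djiE] : exists d, d = partial j di by eexists.
have cij : continuous dij by rewrite dijE djE.
have cji : continuous dji by rewrite djiE diE.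
have di1 : class_C 1 di by rewrite diE; exact: h2.
have dj1 : class_C 1 dj by rewrite djE; exact: h2.
rewrite -djE -diE -dijE -djiE.
pose g z := dij z + - 1 * dji z.
have cN : continuous (fun z => - 1 * dji z).
  by apply: continuous_mul => //; exact: continuous_cstfun.
have cg : continuous g by exact: continuous_add.
have psi0 := @cube_integral_psi_gt0 R.
suff /eqP : g x * cube_integral psi = 0.
  by rewrite mulf_eq0 (gt_eqF psi0) orbF /g mulN1r subr_eq0 => /eqP.
rewrite -cube_conv0; last exact: continuous_psi.
apply: (continuous_eq0_punctured (fun e => cube_conv psi g e x)).
  apply: (continuous_compose (fun p : R * vec => cube_conv psi g p.1 p.2)
    (fun e => (e, x))).
    by apply: continuous_cube_conv => //; exact: continuous_psi.
  by apply: continuous_pairing;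
    [exact: continuous_identity|exact: continuous_cstfun].
move=> e e0; have cpsi := @continuous_psi R.
rewrite (cube_convDr _ _ _ _ _ cpsi cij cN) (cube_convZr _ _ _ _ _ cpsi cji).
apply: (mulfI e0); rewrite mulr0 mulrDr mulrCA.
rewrite (cube_conv_psi_partial dj dij i e x dj1 dijE).
rewrite (cube_conv_psi_partial di dji j e x di1 djiE).
by rewrite (cube_conv_dpsi_swap h di dj i j e x h1 diE djE e0); ring.
Qed.

Section curl_curl.
Variables (f w q : vector_field R).
Hypotheses (f1 : vclass_C 1 f) (w1 : vclass_C 1 w) (q1 : vclass_C 1 q).
Hypotheses (div_f : forall x, divergence f x = 0).
Hypotheses (curl_f : forall x, curl f x = w x) (curl_w : forall x, curl w x = q x).

Lemma curl_coordE (u : vector_field R) j x : curl u x 0 j =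
  partial (j + 1) (component u (j + 2)) x - partial (j + 2) (component u (j + 1)) x.
Proof. by rewrite mxE. Qed.

(** A weak form of curl curl f = - Laplacian f for divergence-free [f]. As [y 0 i * phi y] is
    [- dpsi i y], the sum pairs the gradient of [psi] with that of component [j] of [f]. Exchanging
    the indices [i] and [j] costs components of the curl [w]; the exchanged terms add up to [dpsi j]
    against the divergence, and the curl terms are integrated by parts into [psi] against [q]. *)
Lemma cube_conv_scale_derivative j e x : e != 0 ->
  \sum_i cube_conv (fun y => y 0 i * phi y) (partial i (component f j)) e x =
  - (e * cube_conv psi (component q j) e x).
Proof.
move=> e0.
have [df dfE] : exists d, d = fun a b => partial a (component f b) by eexists.
have [dw dwE] : exists d, d = fun a b => partial a (component w b) by eexists.
have dfab a b : df a b = partial a (component f b) by rewrite dfE.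
have dwab a b : dw a b = partial a (component w b) by rewrite dwE.
have cdf a b : continuous (df a b) by rewrite dfab; exact: continuous_partial.
have cdw a b : continuous (dw a b) by rewrite dwab; exact: continuous_partial.
have cw a : continuous (component w a) by exact: class_C1_continuous.
have cd k : continuous (@dpsi R k) by exact: continuous_dpsi.
have cpsi := @continuous_psi R.
have cZ a (g : vec -> R) : continuous g -> continuous (fun z => a * g z).
  by move=> cg; apply: continuous_mul => //; exact: continuous_cstfun.
have -> : \sum_i cube_conv (fun y => y 0 i * phi y) (partial i (component f j)) e x =
    - \sum_i cube_conv (dpsi i) (df i j) e x.
  rewrite -sumrN; apply: eq_bigr => i _.
  rewrite -dfab -mulN1r -(cube_convZl _ _ _ _ _ (cd i) (cdf i j)).
  by congr cube_conv; apply/funext => y; rewrite /dpsi; ring.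
congr (- _); rewrite (sum_cyclic _ j).
(* Component [j + 2] of curl f = w, solved for a derivative of component [j] of [f]; [e2] comes from
   component [j + 1]. *)
have e1 : df (j + 1) j = fun z => df j (j + 1) z + - 1 * component w (j + 2) z.
  apply/funext => z; rewrite !dfab {3}/component -curl_f curl_coordE add2_1 add2_2.
  by rewrite -!dfab; ring.
have e2 : df (j + 2) j = fun z => df j (j + 2) z + 1 * component w (j + 1) z.
  apply/funext => z; rewrite !dfab {3}/component -curl_f curl_coordE add1_1 add1_2.
  by rewrite -!dfab; ring.
have eq : component q j = fun z => dw (j + 1) (j + 2) z + - 1 * dw (j + 2) (j + 1) z.
  by apply/funext => z; rewrite mulN1r {1}/component -curl_w curl_coordE -!dwab.
rewrite e1 e2 eq.
rewrite (cube_convDr _ _ _ _ _ (cd _) (cdf _ _) (cZ _ _ (cw _))).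
rewrite (cube_convDr _ _ _ _ _ (cd _) (cdf _ _) (cZ _ _ (cw _))).
rewrite (cube_convDr _ _ _ _ _ cpsi (cdw _ _) (cZ _ _ (cdw _ _))).
rewrite (cube_convZr _ _ _ _ _ (cd _) (cw _)) (cube_convZr _ _ _ _ _ (cd _) (cw _)).
rewrite (cube_convZr _ _ _ _ _ cpsi (cdw _ _)).
rewrite (cube_conv_dpsi_swap _ _ _ (j + 1) j e x (f1 (j + 1)) (dfab _ _) (dfab _ _) e0).
rewrite (cube_conv_dpsi_swap _ _ _ (j + 2) j e x (f1 (j + 2)) (dfab _ _) (dfab _ _) e0).
rewrite mulrDr mulrCA (cube_conv_psi_partial _ _ (j + 1) e x (w1 (j + 2)) (dwab _ _)).
rewrite (cube_conv_psi_partial _ _ (j + 2) e x (w1 (j + 1)) (dwab _ _)).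
(* After the swaps every remaining gradient term carries the kernel [dpsi j]; together they
   integrate the divergence. *)
have : cube_conv (dpsi j) (df j j) e x +
    cube_conv (dpsi j) (df (j + 1) (j + 1)) e x +
    cube_conv (dpsi j) (df (j + 2) (j + 2)) e x = 0.
  rewrite -(cube_convDr _ _ _ _ _ (cd j) (cdf _ _) (cdf _ _)).
  rewrite -(cube_convDr _ _ _ _ _ (cd j) (continuous_add _ _ (cdf _ _) (cdf _ _)) (cdf _ _)).
  rewrite -[RHS](sup_bounded_linear0 (@cube_integral_sup_bounded R 3)) cube_convE.
  congr cube_integral; apply/funext => y; rewrite !dfab.
  by rewrite -(sum_cyclic (fun i => partial i (component f i) (e *: y + x)) j)
    -/(divergence f _) div_f mulr0.
lra.
Qed.

Let F01 := @interval_integral_sup_bounded R 0 1 ler01.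

Let continuous_conv_swap (k h : vec -> R) : continuous k -> continuous h ->
  continuous (fun p : vec * R => cube_conv k h p.2 p.1).
Proof.
move=> ck ch; apply: (continuous_compose
  (fun p : R * vec => cube_conv k h p.1 p.2) (fun p : vec * R => (p.2, p.1))).
  exact: continuous_cube_conv.
by apply: continuous_pairing; [exact: continuous_snd|exact: continuous_fst].
Qed.

Let continuous_conv_at1 (k h : vec -> R) : continuous k -> continuous h ->
  continuous (cube_conv k h 1).
Proof.
by move=> ck ch; exact: (continuous_slice _ (1 : R) (continuous_cube_conv _ _ ck ch)).
Qed.

Let cq j : continuous (component q j).
Proof. exact: class_C1_continuous. Qed.

(** The fundamental theorem of calculus in the dilation factor, between the point value at [e = 0]
    and the weighted integral at [e = 1]. *)
Lemma cube_conv_representation j x :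
  component f j x * cube_integral phi = cube_conv phi (component f j) 1 x +
    interval_integral 0 1 (fun e => e * cube_conv psi (component q j) e x).
Proof.
have cf : continuous (component f j) by exact: class_C1_continuous.
have cline (k h : vec -> R) : continuous k -> continuous h ->
    continuous (fun e => cube_conv k h e x).
  by move=> ck ch; exact: (continuous_slice _ x (continuous_conv_swap _ _ ck ch)).
have cpsi : continuous (fun e => e * cube_conv psi (component q j) e x).
  apply: continuous_mul; first exact: continuous_identity.
  by apply: cline => //; exact: continuous_psi.
have := interval_integral_derive 0 1 (fun e => cube_conv phi (component f j) e x)
  (fun e => - 1 * (e * cube_conv psi (component q j) e x)) ltr01 _ _ _.
have [_ -> // _] := F01.
rewrite cube_conv0; last exact: continuous_phi.
move=> H; suff : -1 * interval_integral 0 1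
    (fun e => e * cube_conv psi (component q j) e x) =
  cube_conv phi (component f j) 1 x - component f j x * cube_integral phi by lra.
apply: H.
- by apply: cline => //; exact: continuous_phi.
- by apply: continuous_mul => //; exact: continuous_cstfun.
- move=> e; rewrite in_itv/= => /andP[e0 _].
  apply: (is_derive_fun_eq _ _ _ _ _ _
    (is_derive_cube_conv_scale _ _ e x continuous_phi (f1 j))) => //.
  by rewrite cube_conv_scale_derivative ?gt_eqF// mulN1r.
Qed.

(** The representation formula differentiated in direction [k], with the derivative moved onto the
    kernels. The factor [e] in front of [psi] is exactly what the integration by parts consumes, so
    no power of 1/e appears. *)
Definition partial_repr j k x : R :=
  - 1 * cube_conv (dphi k) (component f j) 1 x +
  interval_integral 0 1 (fun e => - 1 * cube_conv (dpsi k) (component q j) e x).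

Lemma partial_reprE j k x :
  partial k (component f j) x * cube_integral phi = partial_repr j k x.
Proof.
have h1 : is_derive x (delta_mx 0 k) (fun x => cube_integral phi * component f j x)
    (cube_integral phi * partial k (component f j) x).
  by apply: is_derive_mulC; exact: class_C1_is_derive.
have h2 : is_derive x (delta_mx 0 k)
    (fun x => cube_integral phi * component f j x) (partial_repr j k x).
  have e1 : cube_conv phi (partial k (component f j)) 1 x =
      - 1 * cube_conv (dphi k) (component f j) 1 x.
    rewrite -[LHS]mul1r mulN1r; apply: cube_conv_by_parts => //.
    + exact: continuous_phi.
    + exact: continuous_dphi.
    + by move=> y; exact: is_derive_phi.
    + exact: phi_face.
  have cF : continuous (fun p : vec * R => p.2 * cube_conv psi (component q j) p.2 p.1).
    apply: continuous_mul; first exact: continuous_snd.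
    by apply: continuous_conv_swap => //; exact: continuous_psi.
  have cD : continuous (fun p : vec * R => - 1 * cube_conv (dpsi k) (component q j) p.2 p.1).
    apply: continuous_mul; first exact: continuous_cstfun.
    by apply: continuous_conv_swap => //; exact: continuous_dpsi.
  have H := is_derive_sup_bounded_linear (@segment_compact _ _ _) F01 _ _
    (delta_mx 0 k) cF cD.
  apply: (is_derive_fun_eq _ _ _ _ _ _ (is_derive_add _ _ _ _ _ _
    (is_derive_cube_conv_space _ _ 1 x k continuous_phi (f1 j)) (H _ x))).
  - move=> z e /=; apply: (is_derive_fun_eq _ _ _ _ _ _ (is_derive_mulC e _ _ _ _
      (is_derive_cube_conv_space _ _ e z k continuous_psi (q1 j)))) => //.
    by rewrite (cube_conv_psi_partial _ _ k e z (q1 j) (erefl _)) mulN1r.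
  - by move=> z; rewrite [RHS]mulrC cube_conv_representation.
  - by rewrite e1.
rewrite mulrC -(@derive_val _ _ _ _ _ _ _ h1).
exact: (@derive_val _ _ _ _ _ _ _ h2).
Qed.

(** [f] and [q] occur undifferentiated in [partial_repr], so one derivative can fall on each of them
    with a continuous result. *)
Lemma class_C1_partial_repr j k : class_C 1 (partial_repr j k).
Proof.
apply: (class_C1_partials _ (fun l x =>
  - 1 * cube_conv (dphi k) (partial l (component f j)) 1 x +
  interval_integral 0 1
    (fun e => - 1 * cube_conv (dpsi k) (partial l (component q j)) e x))).
- move=> l x; apply: is_derive_add.
    by apply: is_derive_mulC; apply: is_derive_cube_conv_space => //;
      exact: continuous_dphi.
  have cD (g : vec -> R) : continuous g ->
      continuous (fun p : vec * R => - 1 * cube_conv (dpsi k) g p.2 p.1).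
    move=> cg; apply: continuous_mul; first exact: continuous_cstfun.
    by apply: continuous_conv_swap => //; exact: continuous_dpsi.
  apply: (is_derive_sup_bounded_linear (@segment_compact _ _ _) F01 _ _
    (delta_mx 0 l) (cD _ (cq j)) (cD _ (continuous_partial _ l (q1 j)))).
  move=> z e /=; apply: is_derive_mulC; apply: is_derive_cube_conv_space => //.
  exact: continuous_dpsi.
- move=> l; apply: continuous_add.
    apply: continuous_mul; first exact: continuous_cstfun.
    by apply: continuous_conv_at1; [exact: continuous_dphi|exact: continuous_partial].
  apply: (sup_bounded_linear_continuous (@segment_compact _ _ _) F01
    (fun p : vec * R => - 1 * cube_conv (dpsi k) (partial l (component q j)) p.2 p.1)).
  apply: continuous_mul; first exact: continuous_cstfun.
  by apply: continuous_conv_swap; [exact: continuous_dpsi|exact: continuous_partial].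
Qed.

Theorem div_curl_curl_class_C2 : vclass_C 2 f.
Proof.
move=> j; split; first by case: (f1 j).
move=> k; have -> : partial k (component f j) =
    fun x => (cube_integral phi)^-1 * partial_repr j k x.
  apply/funext => x; rewrite -partial_reprE mulrC mulfK//.
  by rewrite gt_eqF// cube_integral_phi_gt0.
have r1 := class_C1_partial_repr j k.
apply: (class_C1_partials _ (fun l x => (cube_integral phi)^-1 * partial l (partial_repr j k) x)).
- by move=> l x; apply: is_derive_mulC; exact: class_C1_is_derive.
- move=> l; apply: continuous_mul; first exact: continuous_cstfun.
  exact: continuous_partial.
Qed.

End curl_curl.

End elliptic_regularity.

(** * The evolution *)

Section linear_combinations.
Context {R : realType}.
Local Notation vec := 'rV[R]_3.
Implicit Types (a b : R) (f g : vec -> R) (u v w : vec -> vec).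

Definition vlin a b u v : vec -> vec := fun x => a *: u x + b *: v x.

Lemma coord_vlin a b u v j :
  component (vlin a b u v) j = fun x => a * component u j x + b * component v j x.
Proof. by apply/funext => x; rewrite /component /vlin !mxE. Qed.

Lemma partial_lin a b f g i :
  (forall x, differentiable f x) -> (forall x, differentiable g x) ->
  partial i (fun x => a * f x + b * g x) =
  fun x => a * partial i f x + b * partial i g x.
Proof.
move=> df dg; apply/funext => x.
have H : is_derive x (delta_mx 0 i) (fun x => a * f x + b * g x)
    (a * partial i f x + b * partial i g x).
  by apply: is_derive_add; apply: is_derive_mulC; apply: DeriveDef => //;
    exact: diff_derivable.
exact: (@derive_val _ _ _ _ _ _ _ H).
Qed.

Lemma class_C_lin m a b f g : class_C m f -> class_C m g ->
  class_C m (fun x => a * f x + b * g x).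
Proof.
have cZ (c : R) (h : vec -> R) : continuous h -> continuous (fun x => c * h x).
  by move=> ch; apply: continuous_mul => //; exact: continuous_cstfun.
elim: m f g => [f g cf cg|m IH f g [df pf] [dg pg]].
  by apply: continuous_add; exact: cZ.
split; last by move=> i; rewrite partial_lin//; apply: IH; [exact: pf|exact: pg].
move=> x; apply: differentiableD.
  exact: (differentiableM (differentiable_cst a x) (df x)).
exact: (differentiableM (differentiable_cst b x) (dg x)).
Qed.

Lemma vclass_C_vlin m a b u v : vclass_C m u -> vclass_C m v ->
  vclass_C m (vlin a b u v).
Proof. by move=> mu mv j; rewrite coord_vlin; exact: class_C_lin. Qed.

Lemma vclass_CS m u : vclass_C m.+1 u -> vclass_C m u.
Proof. by move=> mu j; exact: class_CS. Qed.

Lemma vclass_C1_differentiable u j x : vclass_C 1 u -> differentiable (component u j) x.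
Proof. by move=> /(_ j)[]. Qed.

Lemma partial_coord_vlin a b u v i j : vclass_C 1 u -> vclass_C 1 v ->
  partial i (component (vlin a b u v) j) =
  fun x => a * partial i (component u j) x + b * partial i (component v j) x.
Proof.
by move=> u1 v1; rewrite coord_vlin partial_lin// => x;
  exact: vclass_C1_differentiable.
Qed.

Lemma curl_vlin a b u v x : vclass_C 1 u -> vclass_C 1 v ->
  curl (vlin a b u v) x = a *: curl u x + b *: curl v x.
Proof.
by move=> u1 v1; apply/rowP => j; rewrite !mxE !partial_coord_vlin//; ring.
Qed.

Lemma divergence_vlin a b u v x : vclass_C 1 u -> vclass_C 1 v ->
  divergence (vlin a b u v) x = a * divergence u x + b * divergence v x.
Proof.
move=> u1 v1; rewrite /divergence !mulr_sumr -big_split; apply: eq_bigr => i _.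
by rewrite partial_coord_vlin.
Qed.

Lemma partial2_coord_vlin a b u v i k j : vclass_C 2 u -> vclass_C 2 v ->
  partial i (partial k (component (vlin a b u v) j)) =
  fun x => a * partial i (partial k (component u j)) x +
           b * partial i (partial k (component v j)) x.
Proof.
move=> u2 v2; rewrite partial_coord_vlin; [|exact: vclass_CS..].
by rewrite partial_lin// => x; [case: (u2 j) => _ /(_ k)[]|case: (v2 j) => _ /(_ k)[]].
Qed.

Lemma laplacianE u x j :
  laplacian u x 0 j = \sum_i partial i (partial i (component u j)) x.
Proof. by rewrite mxE. Qed.

Lemma lin_entry a b (p q : vec) j : (a *: p + b *: q) 0 j = a * p 0 j + b * q 0 j.
Proof. by rewrite !mxE. Qed.

Lemma laplacian_vlin a b u v x : vclass_C 2 u -> vclass_C 2 v ->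
  laplacian (vlin a b u v) x = a *: laplacian u x + b *: laplacian v x.
Proof.
move=> u2 v2; apply/rowP => j; rewrite lin_entry.
apply: etrans (laplacianE _ x j) _; apply: etrans _ (esym (congr2
  (fun p q => a * p + b * q) (laplacianE u x j) (laplacianE v x j))).
rewrite (mulr_sumr _ _ _ a) (mulr_sumr _ _ _ b) -big_split; apply: eq_bigr => i _.
exact: (congr1 (fun F => F x) (partial2_coord_vlin a b u v i i j u2 v2)).
Qed.

Lemma on_domain_vlin D a b u v : on_domain D u -> on_domain D v ->
  on_domain D (vlin a b u v).
Proof. by case: D => //= Du Dv i x; rewrite /vlin Du Dv. Qed.

Lemma continuous_vector {T : topologicalType} (F : T -> vec) :
  (forall j, continuous (fun z => F z 0 j)) -> continuous F.
Proof.
move=> cF; rewrite (_ : F = fun z => \sum_j F z 0 j *: delta_mx 0 j).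
  apply: (continuous_sum _ (fun j z => F z 0 j *: (delta_mx 0 j : vec))) => j.
  by apply: continuous_scale => //; exact: continuous_cstfun.
by apply/funext => z; exact: row_sum_delta.
Qed.

Lemma vclass_C1_continuous u : vclass_C 1 u -> continuous u.
Proof. by move=> u1; apply: continuous_vector => j; exact: (class_C1_continuous _ (u1 j)). Qed.

(** The identity curl curl = grad div - Laplacian, with zero divergence. Mixed derivatives are
    exchanged by [partial_comm], hence the C^2 hypothesis. *)
Lemma laplacian_curl_curl u w q x : vclass_C 2 u -> vclass_C 1 w ->
  (forall x, divergence u x = 0) -> (forall x, curl u x = w x) ->
  (forall x, curl w x = q x) -> laplacian u x = - q x.
Proof.
move=> u2 w1 div_u curl_u curl_w; apply/rowP => j.
apply: etrans (laplacianE u x j) _; rewrite (sum_cyclic _ j) [RHS]mxE -curl_w.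
rewrite curl_coordE.
have [df dfE] : exists d, d = fun i k => partial i (component u k) by eexists.
have dfab i k : partial i (component u k) = df i k by rewrite dfE.
have df1 i k : class_C 1 (df i k) by rewrite dfE; case: (u2 k) => _ /(_ i).
have diff_df i k z : differentiable (df i k) z by case: (df1 i k).
have diff_w i z : differentiable (component w i) z by case: (w1 i).
rewrite !dfab.
have e1 : df (j + 1) j =
    fun z => 1 * df j (j + 1) z + - 1 * component w (j + 2) z.
  apply/funext => z; rewrite /component -curl_u curl_coordE add2_1 add2_2.
  by rewrite !dfab; ring.
have e2 : df (j + 2) j =
    fun z => 1 * df j (j + 2) z + 1 * component w (j + 1) z.
  apply/funext => z; rewrite /component -curl_u curl_coordE add1_1 add1_2.
  by rewrite !dfab; ring.
have e3 := partial_comm (component u (j + 1)) (j + 1) j x (u2 _).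
have e4 := partial_comm (component u (j + 2)) (j + 2) j x (u2 _).
rewrite !dfab in e3 e4.
(* The [j]-derivative of the divergence, written as nested combinations with coefficients 1 to match
   [partial_lin]. *)
have div0 : partial j (fun z => 1 * df j j z + 1 *
    (1 * df (j + 1) (j + 1) z + 1 * df (j + 2) (j + 2) z)) x = 0.
  rewrite (_ : (fun _ => _) = fun=> 0); first exact: derive_cst.
  apply/funext => z; rewrite -[RHS](div_u z) /divergence (sum_cyclic _ j) !dfab.
  by ring.
have diff_sum z : differentiable (fun z => 1 * df (j + 1) (j + 1) z +
    1 * df (j + 2) (j + 2) z) z.
  by apply: differentiableD; exact: (differentiableM (differentiable_cst (1 : R) z)
    (diff_df _ _ z)).
rewrite (partial_lin _ _ _ _ _ (diff_df _ _) diff_sum) in div0.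
rewrite (partial_lin _ _ _ _ _ (diff_df _ _) (diff_df _ _)) in div0.
rewrite e1 e2 (partial_lin _ _ _ _ _ (diff_df j (j + 1)) (diff_w (j + 2))).
rewrite (partial_lin _ _ _ _ _ (diff_df j (j + 2)) (diff_w (j + 1))).
by rewrite e3 e4; lra.
Qed.

Lemma is_derive_scale_const (c : R -> R) (t dc : R) (p : vec) :
  is_derive t 1 c dc -> is_derive t 1 (fun s => c s *: p) (dc *: p).
Proof.
move/is_derive_cvgP => cd; apply/is_derive_cvgP.
rewrite (_ : (fun h => _) = (fun h : R => (h^-1 *: (c (h *: 1 + t) - c t)) *: p)).
  by apply: (cvgZr_tmp cd).
by apply/funext => h; rewrite -scalerBl scalerA.
Qed.

End linear_combinations.

(** * Scalar coefficients of the heat flow *)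

Section evolution_coefficients.
Context {R : realType}.
Implicit Types (nu l D s t : R).

Lemma is_derive_exp_linear (c t : R) :
  is_derive t 1 (fun t => expR (c * t)) (c * expR (c * t)).
Proof.
have H := is_derive_mulC c _ _ _ _ (is_derive_id t (1 : R)).
apply: (is_derive_fun_eq _ _ _ _ _ _
  (is_derive_real_comp expR _ _ _ _ _ (is_derive_expR (c * t)) H)) => //.
by rewrite mulr1 mulrC.
Qed.

Lemma is_derive_cos_linear (c t : R) :
  is_derive t 1 (fun t => cos (c * t)) (- c * sin (c * t)).
Proof.
have H := is_derive_mulC c _ _ _ _ (is_derive_id t (1 : R)).
apply: (is_derive_fun_eq _ _ _ _ _ _
  (is_derive_real_comp cos _ _ _ _ _ (is_derive_cos (c * t)) H)) => //.
by rewrite mulr1 mulrC mulrN mulNr.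
Qed.

Lemma is_derive_sin_linear (c t : R) :
  is_derive t 1 (fun t => sin (c * t)) (c * cos (c * t)).
Proof.
have H := is_derive_mulC c _ _ _ _ (is_derive_id t (1 : R)).
apply: (is_derive_fun_eq _ _ _ _ _ _
  (is_derive_real_comp sin _ _ _ _ _ (is_derive_sin (c * t)) H)) => //.
by rewrite mulr1 mulrC.
Qed.

(* For [N ^ 2 = D], [exp (- nu t (l + N) ^ 2) = a t + b t N]. *)
Lemma evolution_coefficients nu l D : exists a b : R -> R,
  [/\ a 0 = 1 /\ b 0 = 0,
      forall t : R, is_derive t 1 a (- nu * ((l ^+ 2 + D) * a t + 2 * l * D * b t)),
      forall t : R, is_derive t 1 b (- nu * ((l ^+ 2 + D) * b t + 2 * l * a t)),
      forall s, 0 < s -> s ^+ 2 = D -> forall t,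
        a t = (expR (- nu * (l + s) ^+ 2 * t) + expR (- nu * (l - s) ^+ 2 * t)) / 2 /\
        b t = (expR (- nu * (l + s) ^+ 2 * t) - expR (- nu * (l - s) ^+ 2 * t)) / (2 * s) &
      D = 0 -> forall t, a t = expR (- nu * l ^+ 2 * t) /\
        b t = - (2 * nu * l * t * expR (- nu * l ^+ 2 * t))].
Proof.
have [D0|D0|D0] := ltgtP D 0.
(* [N] has eigenvalues i w and - i w, and (l + i w)^2 = l^2 - w^2 + 2 i l w: the real part gives the
   rate [c], the imaginary part the frequency [k]. *)
- pose w := Num.sqrt (- D).
  have w0 : 0 < w by rewrite sqrtr_gt0 oppr_gt0.
  have wD : D = - w ^+ 2 by rewrite sqr_sqrtr ?opprK// oppr_ge0 ltW.
  pose c := - nu * (l ^+ 2 + D); pose k := 2 * nu * l * w.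
  exists (fun t => expR (c * t) * cos (k * t)).
  exists (fun t => - w^-1 * (expR (c * t) * sin (k * t))).
  split.
  + by rewrite !mulr0 expR0 cos0 sin0 !mulr0 mulr1.
  + move=> t; apply: (is_derive_fun_eq _ _ _ _ _ _ (is_derive_mul _ _ _ _ _ _
      (is_derive_exp_linear c t) (is_derive_cos_linear k t))) => //.
    by rewrite /c /k wD; field; rewrite gt_eqF.
  + move=> t; apply: (is_derive_fun_eq _ _ _ _ _ _ (is_derive_mulC (- w^-1) _ _ _ _
      (is_derive_mul _ _ _ _ _ _
      (is_derive_exp_linear c t) (is_derive_sin_linear k t)))) => //.
    by rewrite /c /k wD; field; rewrite gt_eqF.
  + by move=> s s0 sD; move: D0; rewrite -sD ltNge sqr_ge0.
  + by move=> D00; move: D0; rewrite D00 ltxx.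
(* [N] has eigenvalues [s] and [- s]; [a] is the half-sum of the two exponentials and [b] their
   half-difference divided by [s]. *)
- pose s := Num.sqrt D.
  have s0 : 0 < s by rewrite sqrtr_gt0.
  have sD : D = s ^+ 2 by rewrite sqr_sqrtr// ltW.
  pose c1 := - nu * (l + s) ^+ 2; pose c2 := - nu * (l - s) ^+ 2.
  exists (fun t => 2^-1 * (expR (c1 * t) + expR (c2 * t))).
  exists (fun t => (2 * s)^-1 * (expR (c1 * t) + - 1 * expR (c2 * t))).
  split.
  + by rewrite !mulr0 expR0; split; [lra|rewrite mulr1 subrr mulr0].
  + move=> t; apply: (is_derive_fun_eq _ _ _ _ _ _ (is_derive_mulC 2^-1 _ _ _ _
      (is_derive_add _ _ _ _ _ _
      (is_derive_exp_linear c1 t) (is_derive_exp_linear c2 t)))) => //.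
    by rewrite sD /c1 /c2; field; rewrite gt_eqF.
  + move=> t; apply: (is_derive_fun_eq _ _ _ _ _ _ (is_derive_mulC (2 * s)^-1 _ _ _ _
      (is_derive_add _ _ _ _ _ _ (is_derive_exp_linear c1 t)
      (is_derive_mulC (- 1) _ _ _ _ (is_derive_exp_linear c2 t))))) => //.
    by rewrite sD /c1 /c2; field; rewrite gt_eqF.
  + move=> s' s'0 s'D t.
    have <- : s = s' by rewrite /s -s'D sqrtr_sqr gtr0_norm.
    by split; rewrite ?mulN1r mulrC.
  + by move=> D00; move: D0; rewrite D00 ltxx.
(* Here N ^ 2 = 0, and the exponential series of - 2 nu l t N stops after its linear term. *)
- pose c := - nu * l ^+ 2.
  exists (fun t => expR (c * t)); exists (fun t => - (2 * nu * l) * (t * expR (c * t))).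
  split.
  + by rewrite mulr0 expR0 mul0r mulr0.
  + move=> t; apply: (is_derive_fun_eq _ _ _ _ _ _ (is_derive_exp_linear c t)) => //.
    by rewrite D0 /c; ring.
  + move=> t; apply: (is_derive_fun_eq _ _ _ _ _ _ (is_derive_mulC (- (2 * nu * l))
      _ _ _ _ (is_derive_mul _ _ _ _ _ _ (is_derive_id t (1 : R))
      (is_derive_exp_linear c t)))) => //.
    by rewrite D0 /c; ring.
  + by move=> s s0 /eqP; rewrite D0 sqrf_eq0 (gt_eqF s0).
  + by move=> _ t; split => //; ring.
Qed.

End evolution_coefficients.

(** * The heat flow on a pair of fields whose span is stable under curl *)

Section evolution.
Context {R : realType}.
Local Notation vec := 'rV[R]_3.
Variables (Dom : domain) (nu l D : R) (a b : R -> R) (f w : vec -> vec).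
Hypotheses (f_dom : on_domain Dom f) (w_dom : on_domain Dom w).
Hypotheses (f1 : vclass_C 1 f) (w1 : vclass_C 1 w).
Hypotheses (div_f : forall x, divergence f x = 0) (div_w : forall x, divergence w x = 0).
Hypotheses (curl_f : forall x, curl f x = l *: f x + w x)
  (curl_w : forall x, curl w x = l *: w x + D *: f x).
Hypotheses
  (da : forall t : R, is_derive t 1 a (- nu * ((l ^+ 2 + D) * a t + 2 * l * D * b t)))
  (db : forall t : R, is_derive t 1 b (- nu * ((l ^+ 2 + D) * b t + 2 * l * a t))).

(** [w] stands for N f, so this is exp (- nu t (l + N) ^ 2) f when [a] and [b] satisfy [da] and [db]
    with initial values 1 and 0. *)
Definition evolve (t : R) : vec -> vec := vlin (a t) (b t) f w.

Let curl_f' x : curl f x = vlin l 1 f w x.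
Proof. by rewrite curl_f /vlin scale1r. Qed.

Let curl_w' x : curl w x = vlin l D w f x.
Proof. exact: curl_w. Qed.

Let curl_curl_f x : curl (vlin l 1 f w) x = vlin (l ^+ 2 + D) (2 * l) f w x.
Proof.
rewrite curl_vlin// curl_f curl_w /vlin.
by apply/rowP => j; rewrite !mxE; ring.
Qed.

Let curl_curl_w x : curl (vlin l D w f) x = vlin (l ^+ 2 + D) (2 * l * D) w f x.
Proof.
rewrite curl_vlin// curl_f curl_w /vlin.
by apply/rowP => j; rewrite !mxE; ring.
Qed.

(** The span of [f] and [w] is stable under curl, so curl f and curl curl f are again C^1 and the
    regularity theorem applies. *)
Lemma evolve_f_class_C2 : vclass_C 2 f.
Proof.
apply: (@div_curl_curl_class_C2 _ f (vlin l 1 f w) (vlin (l ^+ 2 + D) (2 * l) f w)) => //;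
  exact: vclass_C_vlin.
Qed.

Lemma evolve_w_class_C2 : vclass_C 2 w.
Proof.
apply: (@div_curl_curl_class_C2 _ w (vlin l D w f)
  (vlin (l ^+ 2 + D) (2 * l * D) w f)) => //; exact: vclass_C_vlin.
Qed.

Let f2 := evolve_f_class_C2.
Let w2 := evolve_w_class_C2.

Lemma laplacian_f x : laplacian f x = - vlin (l ^+ 2 + D) (2 * l) f w x.
Proof.
by apply: (laplacian_curl_curl f (vlin l 1 f w)) => //; exact: vclass_C_vlin.
Qed.

Lemma laplacian_w x : laplacian w x = - vlin (l ^+ 2 + D) (2 * l * D) w f x.
Proof.
by apply: (laplacian_curl_curl w (vlin l D w f)) => //; exact: vclass_C_vlin.
Qed.

Lemma evolve_time_derivative (t : R) x :
  is_derive t 1 (fun s => evolve s x)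
   ((- nu * ((l ^+ 2 + D) * a t + 2 * l * D * b t)) *: f x +
    (- nu * ((l ^+ 2 + D) * b t + 2 * l * a t)) *: w x).
Proof.
apply: is_deriveD; exact: is_derive_scale_const.
Qed.

Lemma time_derivative_evolve : time_derivative evolve = fun t =>
  vlin (- nu * ((l ^+ 2 + D) * a t + 2 * l * D * b t))
       (- nu * ((l ^+ 2 + D) * b t + 2 * l * a t)) f w.
Proof.
apply/funext => t; apply/funext => x; rewrite /time_derivative derive1E.
exact: (@derive_val _ _ _ _ _ _ _ (evolve_time_derivative t x)).
Qed.

(** On the span of [f] and [w] the Laplacian is - (l + N) ^ 2, and the right-hand sides of [da] and
    [db] are the coefficients of - nu (l + N) ^ 2 (a + b N). *)
Lemma evolve_heat t x : time_derivative evolve t x = nu *: laplacian (evolve t) x.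
Proof.
rewrite time_derivative_evolve laplacian_vlin// laplacian_f laplacian_w /vlin.
by apply/rowP => j; rewrite !mxE; ring.
Qed.

Lemma curl_evolve t x :
  curl (evolve t) x = (l * a t + D * b t) *: f x + (a t + l * b t) *: w x.
Proof.
rewrite curl_vlin// curl_f curl_w.
by apply/rowP => j; rewrite !mxE; ring.
Qed.

Lemma divergence_evolve t x : divergence (evolve t) x = 0.
Proof. by rewrite divergence_vlin// div_f div_w !mulr0 addr0. Qed.

Lemma continuous_of_is_derive (c dc : R -> R) :
  (forall t : R, is_derive t 1 c (dc t)) -> continuous c.
Proof.
move=> dct t; apply: differentiable_continuous; apply/derivable1_diffP.
exact: (@ex_derive _ _ _ _ _ _ _ (dct t)).
Qed.

Let ca : continuous a. Proof. exact: continuous_of_is_derive da. Qed.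
Let cb : continuous b. Proof. exact: continuous_of_is_derive db. Qed.

Lemma jointly_continuous_lin {V : normedModType R} (c d : R -> R) (g h : vec -> V) :
  continuous c -> continuous d -> continuous g -> continuous h ->
  jointly_continuous (fun t x => c t *: g x + d t *: h x).
Proof.
move=> cc cd cg ch; apply: continuous_subspaceT.
apply: continuous_add; apply: continuous_scale.
- by apply: (continuous_compose c fst) => //; exact: continuous_fst.
- by apply: (continuous_compose g snd) => //; exact: continuous_snd.
- by apply: (continuous_compose d fst) => //; exact: continuous_fst.
- by apply: (continuous_compose h snd) => //; exact: continuous_snd.
Qed.

Lemma classical_field_evolve : classical_field Dom evolve.
Proof.
have cf := vclass_C1_continuous f f1; have cw := vclass_C1_continuous w w1.
have cZ (c : R) (g : R -> R) : continuous g -> continuous (fun t => c * g t).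
  by move=> cg; apply: continuous_mul => //; exact: continuous_cstfun.
split.
- by move=> t _; exact: on_domain_vlin.
- by move=> t _; exact: vclass_C_vlin.
- by move=> t x _; exact: (@ex_derive _ _ _ _ _ _ _ (evolve_time_derivative t x)).
- split.
  + exact: jointly_continuous_lin.
  + rewrite time_derivative_evolve; apply: jointly_continuous_lin => //;
      apply: (cZ (- nu)); by apply: continuous_add; exact: cZ.
  + move=> i j.
    rewrite (_ : (fun t => _) = fun t x =>
        a t *: partial i (component f j) x + b t *: partial i (component w j) x).
      by apply: jointly_continuous_lin => //; exact: continuous_partial.
    by apply/funext => t; exact: partial_coord_vlin.
  + move=> i k j.
    rewrite (_ : (fun t => _) = fun t x =>
        a t *: partial i (partial k (component f j)) x +
        b t *: partial i (partial k (component w j)) x).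
      apply: jointly_continuous_lin => //; apply: continuous_partial.
        by case: (f2 j) => _ /(_ k).
      by case: (w2 j) => _ /(_ k).
    by apply/funext => t; exact: partial2_coord_vlin.
Qed.

(** This is the projection (1 + N / s) / 2 applied to [f], with values in the eigenspace of curl for
    [l + s]. Since [s] may be negative, [- s] gives the complementary projection. *)
Lemma beltrami_half s : s != 0 -> s ^+ 2 = D ->
  beltrami Dom (l + s) (vlin 2^-1 (2 * s)^-1 f w).
Proof.
move=> s0 sD; split.
- exact: on_domain_vlin.
- exact: vclass_C_vlin.
- move=> x; rewrite curl_vlin// curl_f curl_w -sD /vlin.
  by apply/rowP => j; rewrite !mxE; field.
- by move=> x; rewrite divergence_vlin// div_f div_w !mulr0 addr0.
Qed.

End evolution.

(** * Cross products and cancellation of the nonlinear terms *)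

Section cross_product.
Context {R : realType}.
Local Notation vec := 'rV[R]_3.

Lemma cross_entry (p r : vec) i :
  cross p r 0 i = p 0 (i + 1) * r 0 (i + 2) - p 0 (i + 2) * r 0 (i + 1).
Proof. by rewrite mxE. Qed.

Lemma cross_linl (c d : R) (p q r : vec) :
  cross (c *: p + d *: q) r = c *: cross p r + d *: cross q r.
Proof. by apply/rowP => i; rewrite !mxE; ring. Qed.

Lemma cross_anti (p q : vec) : cross p q = - cross q p.
Proof. by apply/rowP => i; rewrite !mxE; ring. Qed.

Lemma cross_self (p : vec) : cross p p = 0.
Proof. by apply/rowP => i; rewrite !mxE; ring. Qed.

Lemma curl_opp (g : vec -> vec) x : (forall j y, differentiable (component g j) y) ->
  curl (fun y => - g y) x = - curl g x.
Proof.
move=> dg; apply/rowP => i; rewrite !mxE.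
have pN j k : partial j (component (fun y => - g y) k) x = - partial j (component g k) x.
  rewrite /partial (_ : component (fun y => - g y) k = - component g k).
    by rewrite deriveN//; exact: diff_derivable.
  by apply/funext => y; rewrite /component mxE.
by rewrite !pN; ring.
Qed.

Lemma differentiable_cross (g h : vec -> vec) j y : vclass_C 1 g -> vclass_C 1 h ->
  differentiable (component (fun y => cross (g y) (h y)) j) y.
Proof.
move=> g1 h1; rewrite (_ : component _ j =
    component g (j + 1) * component h (j + 2) - component g (j + 2) * component h (j + 1)).
  by apply: differentiableB; apply: differentiableM; exact: vclass_C1_differentiable.
by apply/funext => z; rewrite /component cross_entry.
Qed.

Lemma grad0 (x : vec) : grad (fun=> 0) x = 0.
Proof. by apply/rowP => i; rewrite !mxE; exact: derive_cst. Qed.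

Lemma class_C1_zero : class_C 1 (fun _ : vec => 0 : R).
Proof.
split=> [x|i]; first exact: differentiable_cst.
rewrite /= (_ : partial i _ = fun=> 0); first exact: continuous_cstfun.
by apply/funext => x; exact: derive_cst.
Qed.

(** The two curl relations give omega x u = - B x u = u x B = J x B, so the momentum equation
    reduces to the heat equation with zero pressure. In the induction equation curl (J x B) = curl
    (u x B) cancels curl (B x u). *)
Lemma hall_mhd_of_double_beltrami (D : domain) (nu alpha beta : R)
    (u B : R -> vec -> vec) :
  classical_field D u -> classical_field D B ->
  (forall t x, divergence (u t) x = 0) -> (forall t x, divergence (B t) x = 0) ->
  (forall t, vclass_C 1 (u t)) -> (forall t, vclass_C 1 (B t)) ->
  (forall t x, curl (u t) x = alpha *: u t x + - 1 *: B t x) ->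
  (forall t x, curl (B t) x = 1 *: u t x + beta *: B t x) ->
  (forall t x, time_derivative u t x = nu *: laplacian (u t) x) ->
  (forall t x, time_derivative B t x = nu *: laplacian (B t) x) ->
  hall_mhd_solution D nu nu u B (fun _ _ => 0).
Proof.
move=> cu cB div_u div_B u1 B1 curl_u curl_B heat_u heat_B; split => //.
  by move=> t _; split; [case: D {cu cB}|exact: class_C1_zero].
move=> t x _ /=; split => //.
- rewrite heat_u grad0 addr0 addrAC subrr add0r curl_u curl_B !cross_linl !cross_self.
  by rewrite [cross (B t x) _]cross_anti scalerN scaleN1r opprK !scaler0 add0r addr0 scale1r.
- rewrite heat_B.
  rewrite (_ : (fun y => cross (curl (B t) y) (B t y)) =
      fun y => - cross (B t y) (u t y)).
    rewrite curl_opp; last by move=> j y; exact: differentiable_cross.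
    by rewrite addrK subrr.
  apply/funext => y; rewrite curl_B cross_linl cross_self scaler0 addr0 scale1r.
  exact: cross_anti.
Qed.

End cross_product.

(** * The exact solution of the Hall MHD system *)

Theorem theorem2p2 (R : realType) (D : domain) (nu eta alpha beta : R)
    (u0 B0 : 'rV[R]_3 -> 'rV[R]_3)
    (nu_eta : nu = eta) (eta_gt0 : 0 < eta)
    (u0_domain : on_domain D u0) (B0_domain : on_domain D B0)
    (u0_C1 : vclass_C 1 u0) (B0_C1 : vclass_C 1 B0)
    (div_u0 : forall x, divergence u0 x = 0)
    (div_B0 : forall x, divergence B0 x = 0)
    (eq_u0 : forall x, B0 x + curl u0 x - alpha *: u0 x = 0)
    (eq_B0 : forall x, u0 x - curl B0 x + beta *: B0 x = 0) :
  exists (u B : R -> 'rV[R]_3 -> 'rV[R]_3) (p : R -> 'rV[R]_3 -> R),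
    [/\ hall_mhd_solution D nu eta u B p,
        u 0 = u0 /\ B 0 = B0,
        2 < `|alpha - beta| ->
          let lambda1 :=
            (alpha + beta + Num.sqrt ((alpha - beta) ^+ 2 - 4)) / 2 in
          let lambda2 :=
            (alpha + beta - Num.sqrt ((alpha - beta) ^+ 2 - 4)) / 2 in
          exists u01 B01 u02 B02 : 'rV[R]_3 -> 'rV[R]_3,
            [/\ beltrami D lambda1 u01 /\ beltrami D lambda1 B01,
                beltrami D lambda2 u02 /\ beltrami D lambda2 B02,
                forall x, u0 x = u01 x + u02 x /\ B0 x = B01 x + B02 x &
                forall t x, 0 <= t ->
                  u t x = expR (- nu * lambda1 ^+ 2 * t) *: u01 x
                          + expR (- nu * lambda2 ^+ 2 * t) *: u02 x /\
                  B t x = expR (- nu * lambda1 ^+ 2 * t) *: B01 x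
                          + expR (- nu * lambda2 ^+ 2 * t) *: B02 x] &
        `|alpha - beta| = 2 ->
          let lambda := (alpha + beta) / 2 in
          forall t x, 0 <= t ->
            u t x = expR (- nu * lambda ^+ 2 * t) *: u0 x
                    - (2 * nu * lambda * t * expR (- nu * lambda ^+ 2 * t))
                        *: (curl u0 x - lambda *: u0 x) /\
            B t x = expR (- nu * lambda ^+ 2 * t) *: B0 x
                    - (2 * nu * lambda * t * expR (- nu * lambda ^+ 2 * t))
                        *: (curl B0 x - lambda *: B0 x)].
subst nu.
pose l : R := (alpha + beta) / 2; pose d : R := (alpha - beta) / 2.
pose D2 : R := d ^+ 2 - 1.
(* These are N u0 and N B0, the companion fields [w] of the two evolutions; [D2] is the scalar N ^
   2. *)
pose wu := vlin d (- 1) u0 B0; pose wB := vlin 1 (- d) u0 B0.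
have curl_u0 x : curl u0 x = alpha *: u0 x + - 1 *: B0 x.
  apply/eqP; rewrite scaleN1r -subr_eq0 -(eq_u0 x); apply/eqP.
  by rewrite opprB addrCA addrA.
have curl_B0 x : curl B0 x = 1 *: u0 x + beta *: B0 x.
  apply/eqP; rewrite scale1r eq_sym -subr_eq0 -(eq_B0 x); apply/eqP.
  by rewrite addrAC.
have wu_curl x : curl u0 x = l *: u0 x + wu x.
  by rewrite curl_u0 /wu /vlin; apply/rowP => j; rewrite !mxE /l /d; field.
have wB_curl x : curl B0 x = l *: B0 x + wB x.
  by rewrite curl_B0 /wB /vlin; apply/rowP => j; rewrite !mxE /l /d; field.
have curl_wu x : curl wu x = l *: wu x + D2 *: u0 x.
  rewrite curl_vlin// curl_u0 curl_B0 /wu /vlin.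
  by apply/rowP => j; rewrite !mxE /D2 /l /d; field.
have curl_wB x : curl wB x = l *: wB x + D2 *: B0 x.
  rewrite curl_vlin// curl_u0 curl_B0 /wB /vlin.
  by apply/rowP => j; rewrite !mxE /D2 /l /d; field.
have wu1 : vclass_C 1 wu by exact: vclass_C_vlin.
have wB1 : vclass_C 1 wB by exact: vclass_C_vlin.
have wu_dom : on_domain D wu by exact: on_domain_vlin.
have wB_dom : on_domain D wB by exact: on_domain_vlin.
have div_wu x : divergence wu x = 0.
  by rewrite divergence_vlin// div_u0 div_B0 !mulr0 addr0.
have div_wB x : divergence wB x = 0.
  by rewrite divergence_vlin// div_u0 div_B0 !mulr0 addr0.
have [a [b [[a0 b0] da db hyperbolic parabolic]]] := evolution_coefficients eta l D2.
exists (evolve a b u0 wu), (evolve a b B0 wB), (fun _ _ => 0); split.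
- apply: (@hall_mhd_of_double_beltrami _ _ _ alpha beta).
  + exact: (classical_field_evolve D eta l D2).
  + exact: (classical_field_evolve D eta l D2).
  + by move=> t x; exact: divergence_evolve.
  + by move=> t x; exact: divergence_evolve.
  + by move=> t; exact: vclass_C_vlin.
  + by move=> t; exact: vclass_C_vlin.
  (* Both evolutions apply the same a t + b t N, which commutes with curl = l + N; hence the initial
     relations persist. *)
  + move=> t x; rewrite (curl_evolve l D2)// /evolve /wu /wB /vlin.
    by apply/rowP => j; rewrite !mxE /D2 /l /d; field.
  + move=> t x; rewrite (curl_evolve l D2)// /evolve /wu /wB /vlin.
    by apply/rowP => j; rewrite !mxE /D2 /l /d; field.
  + by move=> t x; exact: (evolve_heat eta l D2).
  + by move=> t x; exact: (evolve_heat eta l D2).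
- by split; apply/funext => x; rewrite /evolve /vlin a0 b0 scale1r scale0r addr0.
- move=> ab2 lambda1 lambda2.
  (* Half the gap between [lambda1] and [lambda2], which is the positive root of [D2]. *)
  pose s := Num.sqrt ((alpha - beta) ^+ 2 - 4) / 2.
  have ab4 : 0 < (alpha - beta) ^+ 2 - 4.
    rewrite subr_gt0 -real_normK ?num_real// (_ : 4 = 2 ^+ 2); last by ring.
    by rewrite ltrXn2r// nnegrE.
  have s0 : 0 < s by rewrite divr_gt0// sqrtr_gt0.
  have sD : s ^+ 2 = D2.
    by rewrite /s expr_div_n sqr_sqrtr ?ltW// /D2 /d; field.
  have l1 : lambda1 = l + s by rewrite /lambda1 /l /s; field.
  have l2 : lambda2 = l - s by rewrite /lambda2 /l /s; field.
  exists (vlin 2^-1 (2 * s)^-1 u0 wu), (vlin 2^-1 (2 * s)^-1 B0 wB).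
  (* The second summands use [- s], with eigenvalue [l - s], that is [lambda2]; the N parts of the
     two halves cancel in the sum. *)
  exists (vlin 2^-1 (2 * - s)^-1 u0 wu), (vlin 2^-1 (2 * - s)^-1 B0 wB).
  have sn0 : s != 0 by rewrite gt_eqF.
  rewrite l1 l2; split.
  + by split; apply: (beltrami_half _ _ D2).
  + by split; apply: (beltrami_half _ _ D2) => //; rewrite ?oppr_eq0 ?sqrrN.
  + by move=> x; split; apply/rowP => j; rewrite !mxE; field.
  + move=> t x _; rewrite /evolve /vlin; have [-> ->] := hyperbolic s s0 sD t.
    by split; apply/rowP => j; rewrite !mxE; field.
- move=> ab2 lambda t x _.
  have D20 : D2 = 0.
    have : (alpha - beta) ^+ 2 = 4.
      by rewrite -real_normK ?num_real// ab2; ring.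
    by rewrite /D2 /d expr_div_n => ->; field.
  have [ea eb] := parabolic D20 t.
  (* Here [lambda] is [l], so curl u0 - lambda u0 is N u0, the vector that [b t] multiplies;
     likewise for [B0]. *)
  rewrite curl_u0 curl_B0 /evolve /wu /wB /vlin ea eb.
  by split; apply/rowP => j; rewrite !mxE /lambda /l /d; field.
Qed.
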